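(* Let $n$ be an integer greater than $7$. If $\vartheta(A_n,1)\leq 1$ and $\vartheta(A_n,3)\leq 2$, then there exists a pair $P\in\{B_{n-1},C_{n-1}\}$ such that $\delta(P)=\delta(A_n)-3$ and $\vartheta(P,3)\leq 1$.
   Context: Polygons are treated combinatorially: a convex polygon is a finite set of vertices with a clockwise cyclic order; edges are $2$-element vertex sets, two edges cross if disjoint with alternating vertices in the cyclic order; a triangulation is an inclusion-maximal set of pairwise non-crossing edges; for an interior edge $\varepsilon$ of $T$, $T/\varepsilon$ is obtained by replacing $\varepsilon$ by the other diagonal of the unique quadrilateral with diagonal $\varepsilon$ and sides in $T$ (a flip). For a pair $P=\{U,V\}$, $\delta(P)$ is the minimum number of flips transforming $U$ into $V$; a path realizing it is geodesic. For a vertex $a$ with clockwise successor $b$ and a triangulation $T$, $\mathrm{lk}_T(\{a,b\})$ is the unique vertex $x$ with $\{a,x\},\{b,x\}\in T$; a flip $T\to T'$ is incident to $\{a,b\}$ if the links differ; $\vartheta(P,a)$ is the maximum over geodesic paths between $U$ and $V$ of the number of flips incident to $\{a,b\}$. Deletion: for a vertex $a$ of a polygon with at least $4$ vertices, with clockwise successor $b$, $T\ominus a=\{\varepsilon \text{ with } a \text{ replaced by } b:\varepsilon\in T\setminus\{\{a,b\}\}\}$. Zigzag: for $N\geq 4$, on the polygon with vertices $0,\dots,N-1$ labeled clockwise (mod $N$), $Z_N$ is the triangulation whose interior edges are $\varepsilon_{2k+1}=\{2-k,4+k\}$ and $\varepsilon_{2k+2}=\{1-k,4+k\}$ ($k\geq0$),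 for indices $1,\dots,N-3$. In a polygon with $N$ vertices, $\bar k=k+\lfloor N/2\rfloor$. Pair $A_n$ ($n\geq3$): $A_n^-$ is $Z_{n+4}$ with $0,1,\bar0,\bar1$ deleted successively ($\bar k=k+\lfloor (n+4)/2\rfloor$), remaining vertices relabeled clockwise $0,\dots,n-1$ with vertex $2$ keeping label $2$; $A_n^+$ is $Z_{n+4}$ with $4,5,\bar4,\bar5$ deleted successively, relabeled clockwise $0,\dots,n-1$ with former vertex $2$ getting label $1$. Both are triangulations of the polygon with vertices $0,\dots,n-1$; $A_n=\{A_n^-,A_n^+\}$. Pairs $B_n$, $C_n$ ($n\geq 7$): let $T=A_{n+1}^-/\{2,5\}/\{2,4\}/\{2,6\}$ (these edges are flipped in this order; the last flip introduces $\{1,3\}$, which is also an edge of $A_{n+1}^+$). With $E=\{\{1,2\},\{2,3\}\}$, let $B_n^-=T\setminus E$ and $B_n^+=A_{n+1}^+\setminus E$, triangulations of the polygon with vertex $2$ removed; relabel its vertices clockwise $0,\dots,n-1$ so that vertex $3$ keeps its label (i.e. old $n\mapsto0$, $0\mapsto1$, $1\mapsto2$, $k\mapsto k$ for $3\leq k\leq n-1$). Let $C_n^-=B_n^-/\{4,6\}$. Then $B_n=\{B_n^-,B_n^+\}$ and $C_n=\{C_n^-,B_n^+\}$. *)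

(* Defs.v *)
From mathcomp Require Import all_boot all_order all_algebra.

Set Implicit Arguments.
Unset Strict Implicit.
Unset Printing Implicit Defensive.

Import GRing.Theory.

Section Polygon.

Variable V : finType.

Implicit Types (T U W : {set {set V}}) (e f : {set V}) (a b x : V).

(* A polygon is given by the duplicate-free list of its vertices in clockwise
   order, starting from any one of them; nothing below depends on the starting
   point.  The clockwise successor of [a] is [next p a]. *)
Variable p : seq V.

Definition clockwise (s : seq V) : bool :=
  [exists i : 'I_(size p).+1, subseq s (rot i p)].

Definition is_edge e : bool := (#|e| == 2) && [forall x in e, x \in p].

Definition boundary : {set {set V}} := [set [set a; next p a] | a in p].

Definition cross e f : bool :=
  [exists a, exists b, exists c, exists d,
    [&& e == [set a; c], f == [set b; d] & clockwise [:: a; b; c; d]]].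

Definition noncrossing T : bool :=
  [forall e in T, is_edge e && [forall f in T, ~~ cross e f]].

Definition triangulation T : bool := maxset noncrossing T.

(* [e] and [f] are the two diagonals of a quadrilateral with sides in [T]. *)
Definition quad_diagonals T e f : bool :=
  [exists a, exists b, exists c, exists d,
    [&& clockwise [:: a; b; c; d], e == [set a; c], f == [set b; d],
        [set a; b] \in T, [set b; c] \in T, [set c; d] \in T
      & [set d; a] \in T]].

(* T / e; the default value is not used when [e] is an interior edge of a
   triangulation [T]. *)
Definition flip T e : {set {set V}} :=
  if [pick f | quad_diagonals T e f] is Some f then f |: (T :\ e) else T.

Definition flip_step : rel {set {set V}} := fun T U =>
  triangulation T && [exists e in T :\: boundary, U == flip T e].

(* The list [U :: s] is a path of [size s] flips from [U] to [W]. *)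
Definition flip_path U W (s : seq {set {set V}}) : bool :=
  path flip_step U s && (last U s == W).

(* The least length of a flip path from [U] to [W]: a shortest path does not
   repeat a triangulation, so the search range below is large enough
   (lemmas [delta_path] and [delta_min]). *)
Definition delta (P : {set {set V}} * {set {set V}}) : nat :=
  find (fun k => [exists s : k.-tuple {set {set V}}, flip_path P.1 P.2 s])
       (iota 0 #|{set {set V}}|).

(* lk_T({a, b}), with b the clockwise successor of a. *)
Definition link T a : option V :=
  [pick x | ([set a; x] \in T) && ([set next p a; x] \in T)].

Definition incident a T U : bool := link T a != link U a.

Definition theta (P : {set {set V}} * {set {set V}}) a : nat :=
  \max_(s : (delta P).-tuple {set {set V}} | flip_path P.1 P.2 s)
    count id (pairmap (incident a) P.1 s).

Lemma flip_path_short U W s : flip_path U W s ->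
  exists2 k, k <= size s & (k < #|{set {set V}}|) &&
    [exists t : k.-tuple {set {set V}}, flip_path U W t].
Proof.
case/andP=> ps /eqP <-; case: (shortenP ps) => t pt ut sub_ts.
exists (size t).
  by apply: uniq_leq_size => [|x /sub_ts]; first by case/andP: ut.
apply/andP; split; last first.
  by apply/existsP; exists (in_tuple t); rewrite /flip_path pt eqxx.
by have := max_card (mem (U :: t)); rewrite (card_uniqP ut).
Qed.

Lemma delta_path U W s : flip_path U W s ->
  exists t : (delta (U, W)).-tuple {set {set V}}, flip_path U W t.
Proof.
case/flip_path_short=> k _ /andP[ltk Pk]; apply/existsP.
pose Q k := [exists t : k.-tuple {set {set V}}, flip_path U W t].
have hasQ : has Q (iota 0 #|{set {set V}}|).
  by apply/hasP; exists k => //; rewrite mem_iota.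
have := nth_find 0 hasQ; rewrite nth_iota ?add0n //.
by move: hasQ; rewrite has_find size_iota.
Qed.

Lemma delta_min U W s : flip_path U W s -> delta (U, W) <= size s.
Proof.
case/flip_path_short=> k leks /andP[ltk Pk]; apply: leq_trans leks.
rewrite leqNgt; apply/negP=> /(before_find 0).
by rewrite nth_iota // add0n Pk.
Qed.

End Polygon.

Section Deletion.

Variable V : finType.

Implicit Types (p : seq V) (T : {set {set V}}) (a v x : V).

Definition deletion p a T : {set {set V}} :=
  [set [set (if x == a then next p a else x) | x in e]
    | e : {set V} in T :\ [set a; next p a]].

Definition delete (pT : seq V * {set {set V}}) a : seq V * {set {set V}} :=
  (rem a pT.1, deletion pT.1 a pT.2).

(* Clockwise relabeling of the vertices of [p] in Z/nZ, [v] getting label [l]. *)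
Definition relabel n p v (l : nat) x : 'Z_n :=
  (index x (rot (index v p) p) + l)%:R%R.

Definition relabel_triang n p v (l : nat) T : {set {set 'Z_n}} :=
  [set [set relabel n p v l x | x in e] | e : {set V} in T].

End Deletion.

Local Open Scope ring_scope.

(* The polygon with vertices 0, ..., n - 1, as elements of 'Z_n.  As 'Z_n is
   Z/nZ only for n >= 2, the definitions below are meant for n >= 3. *)
Definition polygon (n : nat) : seq 'Z_n := [seq i%:R | i <- iota 0 n].

Definition zigzag_edge (N i : nat) : {set 'Z_N} :=
  let k : 'Z_N := (i.-1)./2%:R in
  if odd i then [set 2 - k; 4 + k] else [set 1 - k; 4 + k].

Definition zigzag (N : nat) : {set {set 'Z_N}} :=
  boundary (polygon N) :|: [set zigzag_edge N i.+1 | i : 'I_(N - 3)].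

Definition bar (N : nat) (k : 'Z_N) : 'Z_N := k + (N./2)%:R.

Definition A_minus (n : nat) : {set {set 'Z_n}} :=
  let N := (n + 4)%N in
  let pT := foldl (@delete 'Z_N) (polygon N, zigzag N)
              [:: 0; 1; bar 0; bar 1] in
  relabel_triang n pT.1 2 2 pT.2.

Definition A_plus (n : nat) : {set {set 'Z_n}} :=
  let N := (n + 4)%N in
  let pT := foldl (@delete 'Z_N) (polygon N, zigzag N)
              [:: 4; 5; bar 4; bar 5] in
  relabel_triang n pT.1 2 1 pT.2.

Definition A (n : nat) := (A_minus n, A_plus n).

Definition remove_ear (n : nat) (T : {set {set 'Z_n.+1}}) : {set {set 'Z_n}} :=
  relabel_triang n (rem 2 (polygon n.+1)) 3 3
    (T :\: [set [set 1; 2]; [set 2; 3]]).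

Definition B_minus (n : nat) : {set {set 'Z_n}} :=
  let flip := flip (polygon n.+1) in
  remove_ear
    (flip (flip (flip (A_minus n.+1) [set 2; 5]) [set 2; 4]) [set 2; 6]).

Definition B_plus (n : nat) : {set {set 'Z_n}} := remove_ear (A_plus n.+1).

Definition C_minus (n : nat) : {set {set 'Z_n}} :=
  flip (polygon n) (B_minus n) [set 4; 6].

Definition B (n : nat) := (B_minus n, B_plus n).

Definition C (n : nat) := (C_minus n, B_plus n).

(* Main.v *)
Require Import Defs.
From mathcomp Require Import all_boot all_order all_algebra.
From mathcomp Require Import zify.

(** A_n^- contains {1,6}, {2,4}, {2,5}, {2,6} and A_n^+ contains {1,3}, so the link
    of {1,2} is 6 at the start of a geodesic and 3 at its end. Since only one flip
    is incident to {1,2}, the edge {1,6} is present until this flip, which replaces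
    {2,6} by {1,3}, and {1,3} is present afterwards. Hence each flip before it takes
    place either inside the hexagon 1, ..., 6 or outside of it. Replace the part inside
    the hexagon by the one found just after the incident flip: either {1,3}, {3,6},
    {4,6} (pair B) or {1,3}, {3,6}, {3,5} (pair C). The flips inside the hexagon become
    trivial, and there are at least three of them because {2,4}, {2,5} and {2,6}
    disappear. Cutting the ear at vertex 2 turns the result into a path between the
    triangulations of P with at most delta(A_n) - 3 flips. Conversely three flips, one
    of which is incident to {3,4}, lead from A_n^- to the first triangulation of P with
    the ear glued back, so that a geodesic for P extends to a geodesic for A_n with at
    least one more flip incident to {3,4}. *)

Set Implicit Arguments.
Unset Strict Implicit.
Unset Printing Implicit Defensive.

Import GRing.Theory.

(** * Chords and crossings of the polygon *)

(** The choice between the two pairs cannot be made in advance: the incident flip takes place in the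
    quadrilateral 1, 2, 3, 6 and leaves the quadrilateral 3, 4, 5, 6 cut by either diagonal. The
    rest of the geodesic starts from that triangulation, so the filling of the hexagon has to agree
    with it. The constant 3 arises because a flip removes a single edge: the three edges at vertex 2
    cost at least three distinct flips, the incident flip itself being the last of them. Two
    preliminaries take much of the work. Geodesics must exist for the bounds on [theta] to say
    anything, which is the connectedness of the flip graph. And the triangulations of the pair A
    must be computed from four successive deletions each; in coordinates counted from the first
    deleted vertex, both sequences of deletions become the same monotone contraction of the
    zigzag. *)

Lemma val_natZ n i : 1 < n -> (i%:R%R : 'Z_n) = i %% n :> nat.
Proof. by move=> n1; rewrite val_Zp_nat. Qed.

Lemma natZ_small n i : i < n -> 1 < n -> (i%:R%R : 'Z_n) = i :> nat.
Proof. by move=> ltin n1; rewrite val_natZ // modn_small. Qed.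

Lemma natZ_inj n i j : 1 < n -> i < n -> j < n ->
  i%:R%R = j%:R%R :> 'Z_n -> i = j.
Proof.
by move=> n1 lti ltj eqij; rewrite -(natZ_small lti n1) eqij natZ_small.
Qed.

Lemma natZ_eq n i j : 1 < n -> i < n -> j < n ->
  (i%:R%R == j%:R%R :> 'Z_n) = (i == j).
Proof.
by move=> n1 lti ltj; apply/eqP/eqP => [/natZ_inj->|->].
Qed.

Lemma natZP n (x : 'Z_n) : 1 < n -> exists2 i, i < n & x = i%:R%R.
Proof.
move=> n1; exists x; last by rewrite natr_Zp.
by have := ltn_ord x; rewrite [X in _ < X](Zp_cast n1).
Qed.

Lemma natZDn n i : 1 < n -> (n + i)%:R%R = i%:R%R :> 'Z_n.
Proof. by move=> n1; apply: val_inj; rewrite /= !val_natZ // modnDl. Qed.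

Lemma mem_polygon n (x : 'Z_n) : 1 < n -> x \in polygon n.
Proof.
by move=> n1; have [i lti ->] := natZP x n1; apply: map_f; rewrite mem_iota.
Qed.

Lemma size_polygon n : size (polygon n) = n.
Proof. by rewrite size_map size_iota. Qed.

Lemma polygon_uniq n : 1 < n -> uniq (polygon n).
Proof.
move=> n1; rewrite map_inj_in_uniq ?iota_uniq // => i j.
by rewrite !mem_iota => /andP[_ lti] /andP[_ ltj]; apply: natZ_inj.
Qed.

Lemma rot_polygon n r : 1 < n -> r <= n ->
  rot r (polygon n) = [seq (r + i)%:R%R | i <- iota 0 n].
Proof.
move=> n1 lern; rewrite /rot -map_drop -map_take drop_iota take_iota add0n.
have -> : iota 0 n = iota 0 (n - r) ++ iota (n - r) r.
  by rewrite -[in LHS](subnK lern) iotaD.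
rewrite map_cat; congr (_ ++ _).
  by rewrite -[X in map _ (iota X _) = _]addn0 iotaDl -map_comp.
rewrite (minn_idPl lern) -[X in _ = map _ (iota X _)]addn0 iotaDl -map_comp.
apply: eq_map => i /=; rewrite -(natZDn i n1); congr (_%:R)%R; lia.
Qed.

(** Cutting the cyclic order just before vertex 0 leaves four possible increasing orders, one per
    disjunct. *)
Definition cyc a b c d :=
  [|| [&& a < b, b < c & c < d], [&& b < c, c < d & d < a],
      [&& c < d, d < a & a < b] | [&& d < a, a < b & b < c]].

Lemma clockwise_natZ n a b c d : 1 < n -> a < n -> b < n -> c < n -> d < n ->
  clockwise (polygon n) [:: a%:R; b%:R; c%:R; d%:R]%R = cyc a b c d.
Proof.
move=> n1 lta ltb ltc ltd.
(* [key r] is the clockwise distance from [r], so the list read from [r] on is sorted by it and its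
   subsequences are the sorted lists. *)
pose key r (x : 'Z_n) : nat := if r <= x then x - r else x + n - r.
pose ltk r : rel 'Z_n := fun x y => key r x < key r y.
have ltk_tr r : transitive (ltk r) by move=> y x z; apply: ltn_trans.
have ltk_irr r : irreflexive (ltk r) by move=> x; apply: ltnn.
have ltk_sorted r : r <= n -> sorted (ltk r) (rot r (polygon n)).
  move=> lern; rewrite rot_polygon // sorted_map.
  have kE i : i < n -> key r (r + i)%:R%R = i.
    move=> lti; rewrite /key val_natZ //.
    have [lt|le] := ltnP (r + i) n; first by rewrite modn_small // leq_addr addKn.
    have -> : (r + i) %% n = r + i - n.
      by rewrite -[in LHS](subnK le) modnDr modn_small //; lia.
    by case: ifP; lia.
  apply: (sub_in_sorted (P := gtn n) _ _ (iota_ltn_sorted 0 n)).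
    by move=> x y /= ltx lty ltxy; rewrite /ltk !kE.
  by apply/allP => i; rewrite mem_iota.
have ltkE r i j : i < n -> j < n -> ltk r i%:R%R j%:R%R =
   ((if r <= i then i - r else i + n - r) < (if r <= j then j - r else j + n - r)).
  by move=> lti ltj; rewrite /ltk /key !natZ_small.
apply/existsP/idP => [[[r /=]]|H].
  rewrite ltnS size_polygon => lern /(subseq_sorted (ltk_tr r)).
  move/(_ (ltk_sorted _ lern)) => /=; rewrite andbT !ltkE // /cyc.
  by do 4!case: ifP; lia.
exists (inord a); rewrite inordK ?size_polygon; last by lia.
set s := [:: _; _; _; _].
have ss : sorted (ltk a) s.
  by rewrite /s /= andbT !ltkE //; move: H; rewrite /cyc; do 4!case: ifP; lia.
(* A list sorted by a strict order is determined by its members. *)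
suff -> : s = filter (mem s) (rot a (polygon n)) by apply: filter_subseq.
apply: (irr_sorted_eq (ltk_tr a) (ltk_irr a) ss).
  apply: sorted_filter => //; apply: ltk_sorted; lia.
by move=> x; rewrite mem_filter /= mem_rot mem_polygon // andbT.
Qed.

(* The chords {i, j} and {k, l} cross: exactly one of [k] and [l] lies strictly
   between [i] and [j], and no endpoint is shared. *)
Definition cr (i j k l : nat) : bool :=
  [|| (i < k < j) && ((l < i) || (j < l)), (j < k < i) && ((l < j) || (i < l)),
      (i < l < j) && ((k < i) || (j < k)) |
      (j < l < i) && ((k < j) || (i < k))].

Definition ed n (T : {set {set 'Z_n}}) (i j : nat) : bool :=
  [set i%:R; j%:R]%R \in T.

Definition same (i j k l : nat) : bool :=
  (i == k) && (j == l) || (i == l) && (j == k).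

Lemma eq_set2 (T : finType) (a b c d : T) :
  ([set a; b] == [set c; d]) = (a == c) && (b == d) || (a == d) && (b == c).
Proof.
apply/eqP/orP => [eqs|[] /andP[/eqP-> /eqP->] //]; last by rewrite setUC.
have : a \in [set c; d] by rewrite -eqs set21.
have : b \in [set c; d] by rewrite -eqs set22.
have : c \in [set a; b] by rewrite eqs set21.
have : d \in [set a; b] by rewrite eqs set22.
rewrite !inE => /orP[]/eqP h1 /orP[]/eqP h2 /orP[]/eqP h3 /orP[]/eqP h4.
all: by subst; rewrite ?eqxx; auto.
Qed.

Lemma eq_set2_natZ n i j k l : 1 < n -> i < n -> j < n -> k < n -> l < n ->
  ([set i%:R; j%:R]%R == [set k%:R; l%:R]%R :> {set 'Z_n}) = same i j k l.
Proof. by move=> *; rewrite eq_set2 !natZ_eq. Qed.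

Lemma cross_natZ n i j k l : 1 < n -> i < n -> j < n -> k < n -> l < n ->
  cross (polygon n) [set i%:R; j%:R]%R [set k%:R; l%:R]%R = cr i j k l.
Proof.
move=> n1 lti ltj ltk ltl; apply/idP/idP.
  case/existsP=> a /existsP[b] /existsP[c] /existsP[d].
  have [a' lta ->] := natZP a n1; have [b' ltb ->] := natZP b n1.
  have [c' ltc ->] := natZP c n1; have [d' ltd ->] := natZP d n1.
  by rewrite clockwise_natZ // !eq_set2_natZ // /same /cyc /cr; lia.
move=> H.
have [C|C] : cyc i k j l \/ cyc i l j k by move: H; rewrite /cr /cyc; lia.
  apply/existsP; exists i%:R%R; apply/existsP; exists k%:R%R.
  apply/existsP; exists j%:R%R; apply/existsP; exists l%:R%R.
  by rewrite clockwise_natZ // C !eqxx.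
apply/existsP; exists i%:R%R; apply/existsP; exists l%:R%R.
apply/existsP; exists j%:R%R; apply/existsP; exists k%:R%R.
by rewrite clockwise_natZ // C eqxx setUC eqxx.
Qed.

Lemma crC i j k l : cr i j k l = cr k l i j.
Proof. by rewrite /cr; lia. Qed.

(** The representative is given by a case distinction rather than a remainder, which keeps the later
    goals within linear arithmetic. *)
Lemma natZ_shift n c i : 1 < n -> i < n -> exists2 i', i' < n &
  (c + i)%:R%R = i'%:R%R :> 'Z_n /\
  i' = if c %% n + i < n then c %% n + i else c %% n + i - n.
Proof.
move=> n1 lti; set c' := c %% n; have ltc : c' < n by rewrite ltn_mod; lia.
have -> : (c + i)%:R%R = (c' + i)%:R%R :> 'Z_n.
  by apply: val_inj; rewrite /= !val_natZ // modnDml.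
case: ltnP => [lt|le]; first by exists (c' + i).
exists (c' + i - n); first by lia.
by split=> //; rewrite -(natZDn (c' + i - n) n1) subnKC.
Qed.

Lemma natZ_shiftP n c (x : 'Z_n) : 1 < n -> exists2 i, i < n & x = (c + i)%:R%R.
Proof.
move=> n1; have [i lti xE] := natZP (x - c%:R)%R n1.
by exists i => //; rewrite natrD -xE addrC subrK.
Qed.

(** Clockwise order of three vertices. Unlike [<] it is invariant under rotation, so the invariance
    of crossings is obtained by expressing them through it. *)
Definition cyc3 a b c := [|| a < b < c, b < c < a | c < a < b].

Lemma cr_cyc3 i j k l :
  cr i j k l = cyc3 i k j && cyc3 i j l || cyc3 i l j && cyc3 i j k.
Proof. by rewrite /cr /cyc3; lia. Qed.

Lemma cyc3_shift n d a b c a' b' c' : d < n -> a < n -> b < n -> c < n ->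
  a' = (if d + a < n then d + a else d + a - n) ->
  b' = (if d + b < n then d + b else d + b - n) ->
  c' = (if d + c < n then d + c else d + c - n) ->
  cyc3 a' b' c' = cyc3 a b c.
Proof.
by move=> ltd lta ltb ltc; rewrite /cyc3; do 3![case: ltnP => ? ->]; lia.
Qed.

Lemma cross_shift n c i j k l : 1 < n -> i < n -> j < n -> k < n -> l < n ->
  cross (polygon n) [set (c + i)%:R; (c + j)%:R]%R [set (c + k)%:R; (c + l)%:R]%R
    = cr i j k l.
Proof.
move=> n1 lti ltj ltk ltl; have ltc : c %% n < n by rewrite ltn_mod; lia.
have [i' lti' [-> Ei]] := natZ_shift c n1 lti.
have [j' ltj' [-> Ej]] := natZ_shift c n1 ltj.
have [k' ltk' [-> Ek]] := natZ_shift c n1 ltk.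
have [l' ltl' [-> El]] := natZ_shift c n1 ltl.
by rewrite cross_natZ // !cr_cyc3; congr (_ && _ || _ && _);
  apply: (cyc3_shift ltc).
Qed.

Lemma eq_natZ_shift n c i j : 1 < n -> i < n -> j < n ->
  ((c + i)%:R == (c + j)%:R :> 'Z_n)%R = (i == j).
Proof.
by move=> n1 lti ltj; rewrite !natrD (inj_eq (addrI _)) natZ_eq.
Qed.

Lemma is_edge_shift n c i j : 1 < n -> i < n -> j < n ->
  is_edge (polygon n) [set (c + i)%:R; (c + j)%:R]%R = (i != j).
Proof.
move=> n1 lti ltj; rewrite /is_edge cards2 eq_natZ_shift // eqSS eqb1.
apply/andb_idr => _; apply/forallP => x; apply/implyP => _.
exact: mem_polygon.
Qed.

Lemma is_edgeP n c e : 1 < n -> is_edge (polygon n) e ->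
  exists i j, [/\ i < n, j < n, i != j & e = [set (c + i)%:R; (c + j)%:R]%R].
Proof.
move=> n1 ee; have /andP[/cards2P[x [y [_ eE]]] _] := ee.
have [i lti xE] := natZ_shiftP c x n1; have [j ltj yE] := natZ_shiftP c y n1.
by exists i, j; move: ee; rewrite eE xE yE is_edge_shift.
Qed.

(** A maximal non-crossing set consists of exactly those chords that cross none of its members. The
    origin [c] is left free because the zigzag and its contractions are simplest when counted from a
    vertex other than 0. *)
Lemma triangulation_shiftP n c (T : {set {set 'Z_n}}) : 1 < n ->
  triangulation (polygon n) T <->
  (forall e, e \in T -> exists i j,
     [/\ i < n, j < n, i != j & e = [set (c + i)%:R; (c + j)%:R]%R]) /\
  (forall i j, i < n -> j < n -> ed T (c + i) (c + j) <->
     i != j /\ forall k l, k < n -> l < n -> ed T (c + k) (c + l) ->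
                 ~~ cr i j k l).
Proof.
move=> n1; split.
  case/maxsetP=> /forallP ncT maxT; split=> [e eT|i j lti ltj].
    by apply: is_edgeP => //; have /implyP/(_ eT)/andP[] := ncT e.
  split=> [eT|[neij ncij]].
    have /implyP/(_ eT)/andP[] := ncT [set (c + i)%:R; (c + j)%:R]%R.
    rewrite is_edge_shift // => -> /forallP nc; split=> // k l ltk ltl eT'.
    by have /implyP/(_ eT') := nc [set (c + k)%:R; (c + l)%:R]%R; rewrite cross_shift.
  rewrite /ed; set e := [set (c + i)%:R; (c + j)%:R]%R.
  suff <- : e |: T = T by rewrite inE set11.
  apply: maxT; last exact: subsetUr.
  have ncT1 f : f \in T -> ~~ cross (polygon n) e f /\ ~~ cross (polygon n) f e.
    move=> fT; have /implyP/(_ fT)/andP[ef _] := ncT f.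
    have [k [l [ltk ltl _ fE]]] := is_edgeP c n1 ef; subst f.
    by rewrite /e !cross_shift // (crC k) (negPf (ncij _ _ _ _ fT)).
  apply/forallP=> f; apply/implyP; case/setU1P => [->|fT].
    rewrite is_edge_shift // neij; apply/forallP=> g; apply/implyP.
    case/setU1P=> [->|/ncT1[]//]; rewrite cross_shift // /cr; lia.
  have /implyP/(_ fT)/andP[-> /forallP ncf] := ncT f.
  apply/forallP=> g; apply/implyP; case/setU1P=> [->|]; first by case: (ncT1 f fT).
  exact: (implyP (ncf g)).
case=> edT ncT; apply/maxsetP; split.
  apply/forallP=> e; apply/implyP=> eT; have [i [j [lti ltj neij eE]]] := edT e eT.
  rewrite eE is_edge_shift // neij; apply/forallP=> f; apply/implyP=> fT.
  have [k [l [ltk ltl nekl fE]]] := edT f fT; rewrite fE cross_shift //.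
  have [h _] := ncT i j lti ltj; rewrite /ed -eE in h; have [_ {}h] := h eT.
  by apply: h => //; rewrite /ed -fE.
move=> B /forallP ncB sTB; apply/eqP; rewrite eqEsubset sTB andbT.
apply/subsetP=> e eB; have /implyP/(_ eB)/andP[ee /forallP nce] := ncB e.
have [i [j [lti ltj neij eE]]] := is_edgeP c n1 ee.
rewrite eE; apply/(ncT i j lti ltj); split=> // k l ltk ltl eT.
have /implyP := nce [set (c + k)%:R; (c + l)%:R]%R.
by rewrite eE cross_shift //; apply; apply: (subsetP sTB).
Qed.

Lemma edC n (T : {set {set 'Z_n}}) i j : ed T i j = ed T j i.
Proof. by rewrite /ed setUC. Qed.

(** * Edges and triangles of a triangulation, counted from an arbitrary origin *)

Section Triangulation.

Variables (n : nat) (T : {set {set 'Z_n}}).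
Hypothesis n1 : 1 < n.
Hypothesis triT : triangulation (polygon n) T.

Lemma tri_edge e : e \in T ->
  exists i j, [/\ i < n, j < n, i < j & e = [set i%:R; j%:R]%R].
Proof.
have [edT _] := (triangulation_shiftP 0 T n1).1 triT.
move=> /edT[i [j [lti ltj ne ->]]].
by case: (ltngtP i j) ne => // ltij _; [exists i, j | exists j, i; rewrite setUC].
Qed.

Lemma tri_nc c i j k l : i < n -> j < n -> k < n -> l < n ->
  ed T (c + i) (c + j) -> ed T (c + k) (c + l) -> ~~ cr i j k l.
Proof.
have [_ ncT] := (triangulation_shiftP c T n1).1 triT.
by move=> lti ltj ltk ltl /(ncT i j lti ltj)[_]; apply.
Qed.

Lemma tri_max c i j : i < n -> j < n -> i != j ->
  (forall k l, k < n -> l < n -> k < l -> ed T (c + k) (c + l) -> ~~ cr i j k l) ->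
  ed T (c + i) (c + j).
Proof.
have [_ ncT] := (triangulation_shiftP c T n1).1 triT.
move=> lti ltj neij H; apply/ncT => //; split=> // k l ltk ltl ekl.
case: (ltngtP k l) => [?|?|->]; [exact: H| |by rewrite /cr; lia].
have -> : cr i j k l = cr i j l k by rewrite /cr; lia.
by apply: H; rewrite // edC.
Qed.

Lemma tri_neq i j : i < n -> j < n -> ed T i j -> i != j.
Proof.
have [_ ncT] := (triangulation_shiftP 0 T n1).1 triT.
by move=> lti ltj /(ncT i j lti ltj)[].
Qed.

Lemma tri_nc0 i j k l : i < n -> j < n -> k < n -> l < n ->
  ed T i j -> ed T k l -> ~~ cr i j k l.
Proof. exact: (@tri_nc 0). Qed.

Lemma tri_max0 i j : i < n -> j < n -> i != j ->
  (forall k l, k < n -> l < n -> k < l -> ed T k l -> ~~ cr i j k l) -> ed T i j.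
Proof. exact: (@tri_max 0). Qed.

Lemma tri_side c i : i.+1 < n -> ed T (c + i) (c + i.+1).
Proof.
move=> lti; apply: tri_max; rewrite ?(ltnW lti) //; first lia.
by move=> k l *; rewrite /cr; lia.
Qed.

Lemma tri_side0 i : i.+1 < n -> ed T i i.+1.
Proof. exact: (@tri_side 0). Qed.

Lemma tri_base c : ed T (c + 0) (c + n.-1).
Proof. by apply: tri_max; try lia; move=> k l *; rewrite /cr; lia. Qed.

Lemma tri_base0 : ed T 0 n.-1.
Proof. exact: (@tri_base 0). Qed.

(* The apex is the last neighbour of [i] before [j]. *)
Lemma tri_split c i j : i.+1 < j -> j < n -> ed T (c + i) (c + j) ->
  exists k, [/\ i < k, k < j, ed T (c + i) (c + k) & ed T (c + k) (c + j)].
Proof.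
move=> ltij ltj eij.
pose P k := [&& i < k, k < j & ed T (c + i) (c + k)].
have exP : exists k, P k by exists i.+1; rewrite /P leqnn ltij tri_side //; lia.
have [|k /and3P[ltik ltkj eik] maxk] := ex_maxnP exP (m := j).
  by move=> k /and3P[_ /ltnW].
exists k; split=> //; apply: tri_max; try lia.
(* An edge that crosses {k, j} but neither {i, j} nor {i, k} joins i to a vertex between k and j,
   against the maximality of k. *)
move=> x y ltx lty ltxy exy; apply/negP=> crx.
have := tri_nc (c := c) _ _ _ _ eij exy; have := tri_nc (c := c) _ _ _ _ eik exy.
have Py : x = i -> k < y < j -> False.
  by move=> xi lty'; have := maxk y; rewrite /P -xi exy xi; lia.
move: crx; rewrite /cr; have [xi|] := eqVneq x i; lia.
Qed.

End Triangulation.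

(** Maximality follows by descent from the base {0, n-1}: a chord below {i, j} that crosses no edge
    lies below one of the other two sides of the triangle i, k, j, until it coincides with a
    side. *)
Lemma tri_of_split n c (T : {set {set 'Z_n}}) : 1 < n ->
  (forall e, e \in T -> exists i j,
     [/\ i < j, j < n & e = [set (c + i)%:R; (c + j)%:R]%R]) ->
  ed T (c + 0) (c + n.-1) ->
  (forall i j k l, i < k < j -> j < l < n -> ed T (c + i) (c + j) ->
     ed T (c + k) (c + l) -> False) ->
  (forall i j, i.+1 < j -> j < n -> ed T (c + i) (c + j) ->
     exists k, [/\ i < k, k < j, ed T (c + i) (c + k) & ed T (c + k) (c + j)]) ->
  triangulation (polygon n) T.
Proof.
move=> n1 edT base nc spl; apply/(triangulation_shiftP c) => //; split.
  by move=> e /edT[i [j [ltij ltj ->]]]; exists i, j; split=> //; lia.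
have neq i j : i < n -> j < n -> ed T (c + i) (c + j) -> i != j.
  move=> lti ltj eij; apply/eqP => ij.
  have [i' [j' [ltij ltj' /eqP]]] := edT _ eij.
  by rewrite eq_set2 !eq_natZ_shift //; lia.
have ncT i j k l : i < n -> j < n -> k < n -> l < n ->
    ed T (c + i) (c + j) -> ed T (c + k) (c + l) -> ~~ cr i j k l.
  move=> lti ltj ltk ltl eij ekl; apply/negP=> H.
  have eji : ed T (c + j) (c + i) by rewrite edC.
  have elk : ed T (c + l) (c + k) by rewrite edC.
  have h1 := nc i j k l; have h2 := nc i j l k; have h3 := nc j i k l.
  have h4 := nc j i l k; have h5 := nc k l i j; have h6 := nc k l j i.
  have h7 := nc l k i j; have h8 := nc l k j i.
  move: H; rewrite /cr; lia.
have max d i j a b : j - i < d -> i <= a -> a < b -> b <= j -> j < n ->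
    ed T (c + i) (c + j) ->
    (forall k l, k < n -> l < n -> ed T (c + k) (c + l) -> ~~ cr a b k l) ->
    ed T (c + a) (c + b).
  elim: d i j => // d IHd i j ltd leia ltab lebj ltj eij ncab.
  have [iaE|neia] := eqVneq i a; have [bjE|nebj] := eqVneq b j; subst => //.
  - have [|||k [ltik ltkj eik ekj]] := spl a j; try lia.
    have [leak|ltka] := leqP b k; first by apply: (IHd a k) => //; lia.
    by have := ncab k j _ _ ekj; rewrite /cr; lia.
  - have [|||k [ltik ltkj eik ekj]] := spl i j; try lia.
    have [leka|ltak] := leqP k a; first by apply: (IHd k j) => //; lia.
    by have := ncab i k _ _ eik; rewrite /cr; lia.
  have [|||k [ltik ltkj eik ekj]] := spl i j; try lia.
  have [leka|ltak] := leqP k a; first by apply: (IHd k j) => //; lia.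
  have [lebk|ltkb] := leqP b k; first by apply: (IHd i k) => //; lia.
  by have := ncab i k _ _ eik; rewrite /cr; lia.
move=> i j lti ltj; split=> [eij|[neij ncij]].
  by split=> [|k l ltk ltl ekl]; [apply: neq | apply: ncT].
wlog ltij : i j lti ltj neij ncij / i < j.
  move=> W; case: (ltngtP i j) neij => // ltij _; first by apply: W; rewrite ?neq_ltn ?ltij.
  rewrite edC; apply: W; rewrite ?neq_ltn ?ltij // => k l ltk ltl ekl.
  have -> : cr j i k l = cr i j k l by rewrite /cr; lia.
  exact: ncij.
by apply: (max n 0 n.-1); try lia.
Qed.

(** By maximality of [T], one inclusion is enough. *)
Lemma tri_ext n (T U : {set {set 'Z_n}}) : 1 < n ->
  triangulation (polygon n) T -> triangulation (polygon n) U ->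
  (forall i j, i < n -> j < n -> i < j -> ed T i j -> ed U i j) -> T = U.
Proof.
move=> n1 triT triU sTU.
have /maxsetP[_ maxT] := triT; apply/esym/maxT; first by case/maxsetP: triU.
by apply/subsetP => e eT; have [i [j [lti ltj ltij eE]]] := tri_edge n1 triT eT;
  subst e; apply: sTU.
Qed.

(** * Flips *)

Lemma cr_lt i j k l : i < j -> k < l ->
  cr i j k l = [&& i < k, k < j & j < l] || [&& k < i, i < l & l < j].
Proof. by rewrite /cr; lia. Qed.

Lemma crCr x y a b : cr x y a b = cr x y b a.
Proof. by rewrite /cr; lia. Qed.

Lemma crCl x y a b : cr x y a b = cr y x a b.
Proof. by rewrite /cr; lia. Qed.

Lemma sameCl x y a b : same x y a b = same y x a b.
Proof. by rewrite /same; lia. Qed.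

Lemma sameCr x y a b : same x y a b = same x y b a.
Proof. by rewrite /same; lia. Qed.

(** A chord that crosses a diagonal but no side is trapped inside the quadrilateral, where only the
    other diagonal is left. *)
Lemma quad_diagonal_lt a b c d x y : a < b -> b < c -> c < d -> x < y ->
  ~~ cr x y a b -> ~~ cr x y b c -> ~~ cr x y c d -> ~~ cr x y a d ->
  (cr x y a c -> same x y b d) /\ (cr x y b d -> same x y a c).
Proof.
move=> ltab ltbc ltcd ltxy; rewrite !cr_lt //; try lia.
by rewrite /same; lia.
Qed.

Lemma quad_diagonal a b c d x y : cr a c b d ->
  ~~ cr x y a b -> ~~ cr x y b c -> ~~ cr x y c d -> ~~ cr x y d a ->
  cr x y a c -> same x y b d.
Proof.
wlog ltac : a c / a < c.
  move=> W H ab bc cd da ac.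
  have [|] : a < c \/ c < a by move: H; rewrite /cr; lia.
    by move=> /W; apply.
  by move=> /W; apply; rewrite crCr // crCl crCr.
wlog ltbd : b d / b < d.
  move=> W H ab bc cd da ac.
  have [|] : b < d \/ d < b by move: H; rewrite /cr; lia.
    by move=> /W; apply.
  by rewrite sameCr => /W; apply; rewrite // crCr.
wlog ltxy : x y / x < y.
  move=> W H ab bc cd da ac.
  have [|] : x < y \/ y < x by move: ac; rewrite /cr; lia.
    by move=> /W; apply.
  by rewrite sameCl => /W; apply; rewrite // crCl.
move=> H ab bc cd da.
have [[h1 [h2 h3]]|[h1 [h2 h3]]] :
    (a < b /\ b < c /\ c < d) \/ (b < a /\ a < d /\ d < c).
  by move: H; rewrite cr_lt //; lia.
  by case: (quad_diagonal_lt h1 h2 h3 ltxy ab bc cd) => //; rewrite crCr.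
by case: (quad_diagonal_lt h1 h2 h3 ltxy) => //; rewrite crCr.
Qed.

Lemma cr_neq a b c d : cr a c b d ->
  [&& a != b, b != c, c != d, d != a & (a != c) && (b != d)].
Proof. by rewrite /cr; lia. Qed.

Lemma side_not_diagonal a b c d i k : cr a c b d -> same a c i k ->
  [&& ~~ same a b i k, ~~ same b c i k, ~~ same c d i k & ~~ same d a i k].
Proof. by move=> /cr_neq; rewrite /same; lia. Qed.

(** A flip whose new edge is named instead of picked, so that membership can be computed;
    [flip_quad] relates it to [flip]. *)
Definition exchange n (T : {set {set 'Z_n}}) (a b c d : nat) : {set {set 'Z_n}} :=
  [set b%:R; d%:R]%R |: T :\ [set a%:R; c%:R]%R.

Definition quad n (T : {set {set 'Z_n}}) a b c d : Prop :=
  [/\ [&& a < n, b < n, c < n & d < n], cr a c b d,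
      ed T a b && ed T b c, ed T c d && ed T d a & ed T a c].

Lemma ed_exchange n (T : {set {set 'Z_n}}) a b c d i j : 1 < n ->
  a < n -> b < n -> c < n -> d < n -> i < n -> j < n ->
  ed (exchange T a b c d) i j = same i j b d || ~~ same i j a c && ed T i j.
Proof. by move=> *; rewrite /ed /exchange !inE !eq_set2_natZ. Qed.

Lemma next_polygon n i : 1 < n -> i < n ->
  next (polygon n) i%:R%R = i.+1%:R%R.
Proof.
move=> n1 lti; rewrite next_nth mem_polygon //.
have -> : index (i%:R%R : 'Z_n) (polygon n) = i.
  have iE : nth 0%R (polygon n) i = i%:R%R.
    by rewrite (nth_map 0) ?size_iota // nth_iota.
  by rewrite -[X in index X]iE index_uniq ?size_polygon ?polygon_uniq.
case: n n1 lti => // n n1 lti; rewrite /polygon /=.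
have [ltin|] := ltnP i n; first by rewrite (nth_map 0) ?size_iota // nth_iota // add1n.
move=> lein; have -> : i = n by lia.
rewrite nth_default ?size_map ?size_iota //.
by have := natZDn 0 n1; rewrite addn0 => ->.
Qed.

Lemma boundary_natZ n i j : 1 < n -> i < j -> j < n ->
  ([set i%:R; j%:R]%R \in boundary (polygon n)) = (j == i.+1) || (i == 0) && (j == n.-1).
Proof.
move=> n1 ltij ltj; have lti := ltn_trans ltij ltj.
apply/imsetP/idP => [[a _ /eqP]|].
  have [k ltk ->] := natZP a n1; rewrite next_polygon //.
  have [ltk'|] := ltnP k.+1 n; first by rewrite eq_set2_natZ // /same; lia.
  move=> lek; have kE : k.+1 = n + 0 by lia.
  by rewrite kE natZDn // eq_set2_natZ // /same; lia.
case/orP=> [/eqP jE|/andP[/eqP iE /eqP jE]].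
  by exists i%:R%R; rewrite ?mem_polygon // next_polygon // jE.
exists j%:R%R; rewrite ?mem_polygon // next_polygon // setUC iE.
have -> : j.+1 = n + 0 by lia.
by rewrite natZDn // jE.
Qed.

Section Flip.

Variables (n : nat) (T : {set {set 'Z_n}}).
Hypothesis n1 : 1 < n.
Hypothesis triT : triangulation (polygon n) T.

Lemma tri_exchange a b c d : quad T a b c d ->
  triangulation (polygon n) (exchange T a b c d).
Proof.
case=> /and4P[lta ltb ltc ltd] cross /andP[ab bc] /andP[cd da] ac.
have nc x y : x < n -> y < n -> ed T x y -> cr x y b d -> same x y a c.
  move=> ltx lty exy crx; rewrite sameCr.
  have nc' := tri_nc0 n1 triT ltx lty.
  by apply: (@quad_diagonal b c d a) => //; rewrite ?nc' // crCr crC.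
apply/(triangulation_shiftP 0) => //; split=> [e|i j lti ltj].
  rewrite !inE => /orP[/eqP->|/andP[_ /(tri_edge n1 triT)]].
    by exists b, d; split=> //; move: cross; rewrite /cr; lia.
  by move=> [i [j [? ? ? ->]]]; exists i, j; split=> //; lia.
rewrite !add0n !ed_exchange //; split.
  case/orP=> [sbd|/andP[nsac eij]].
    split=> [|k l ltk ltl]; first by have := cr_neq cross; move: sbd; rewrite /same; lia.
    rewrite !add0n !ed_exchange // => /orP[skl|/andP[nskl ekl]].
      by case/orP: sbd => /andP[/eqP-> /eqP->];
        case/orP: skl => /andP[/eqP-> /eqP->]; rewrite /cr; lia.
    apply/negP=> cr1; case/negP: nskl; apply: nc => //; rewrite crC.
    by case/orP: sbd cr1 => /andP[/eqP-> /eqP->] //; rewrite crCl.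
  split=> [|k l ltk ltl]; first exact: tri_neq eij.
  rewrite !add0n !ed_exchange // => /orP[skl|/andP[nskl ekl]]; last exact: (tri_nc0 n1 triT).
  apply/negP=> cr1; case/negP: nsac; apply: nc => //.
  by case/orP: skl cr1 => /andP[/eqP-> /eqP->] //; rewrite crCr.
case=> neij ncij.
have ncT k l : k < n -> l < n -> ed T k l -> ~~ same k l a c -> ~~ cr i j k l.
  by move=> ltk ltl ekl ns; apply: ncij => //; rewrite !add0n ed_exchange // ekl ns orbT.
have ncbd : ~~ cr i j b d.
  by apply: ncij => //; rewrite !add0n ed_exchange // /same !eqxx.
(* For maximality: a compatible chord that crosses {a, c} is trapped in the quadrilateral and equals
   {b, d}; one that does not cross it crosses nothing in [T] and was already there. *)
have [crac|ncac] := boolP (cr i j a c).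
  have sac : same a c a c by rewrite /same !eqxx.
  have /and4P[s1 s2 s3 s4] := side_not_diagonal cross sac.
  by rewrite (@quad_diagonal a b c d) //; apply: ncT.
apply/orP; right; apply/andP; split.
  apply/negP=> sac; case/negP: ncbd; case/orP: sac => /andP[/eqP-> /eqP->] //.
  by rewrite crCl.
apply: tri_max0 => // k l ltk ltl _ ekl.
have [skl|nskl] := boolP (same k l a c); last exact: ncT.
by case/orP: skl ncac => /andP[/eqP-> /eqP->] //; rewrite crCr.
Qed.

Lemma quad_diagonalsP e f : quad_diagonals (polygon n) T e f ->
  exists a b c d, [/\ [&& a < n, b < n, c < n & d < n], cr a c b d,
    ed T a b && ed T b c, ed T c d && ed T d a
    & e = [set a%:R; c%:R]%R /\ f = [set b%:R; d%:R]%R].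
Proof.
case/existsP=> a /existsP[b] /existsP[c] /existsP[d].
have [a' lta ->] := natZP a n1; have [b' ltb ->] := natZP b n1.
have [c' ltc ->] := natZP c n1; have [d' ltd ->] := natZP d n1.
rewrite clockwise_natZ // => /and5P[C /eqP-> /eqP-> ab /and3P[bc cd da]].
exists a', b', c', d'; rewrite /ed ab bc cd da lta ltb ltc ltd; split=> //.
by move: C; rewrite /cyc /cr; lia.
Qed.

(** Whatever diagonal [pick] returns crosses {a, c} but no side of the quadrilateral a, b, c, d,
    hence it is {b, d}. *)
Lemma flip_quad a b c d : quad T a b c d ->
  flip (polygon n) T [set a%:R; c%:R]%R = exchange T a b c d.
Proof.
case=> /and4P[lta ltb ltc ltd] cross /andP[ab bc] /andP[cd da] ac.
rewrite /flip; case: pickP => [f|].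
  case/quad_diagonalsP=> i [j [k [l]]].
  case=> /and4P[lti ltj ltk ltl] cross' /andP[ij jk] /andP[kl li] [/eqP + ->].
  rewrite eq_set2_natZ // => sm.
  have eik : ed T i k.
    by case/orP: sm ac => /andP[/eqP-> /eqP->] //; rewrite edC.
  have qT : quad T i j k l by split; rewrite ?ij ?jk ?kl ?li // lti ltj ltk ltl.
  have triU := tri_exchange qT.
  have ejl : ed (exchange T i j k l) j l by rewrite ed_exchange // /same !eqxx.
  suff : same j l b d.
    by rewrite /exchange -(eq_set2_natZ n1) // => /eqP->.
  have nc x y : x < n -> y < n -> ed T x y -> ~~ same x y i k -> ~~ cr j l x y.
    move=> ltx lty exy ns; apply: (tri_nc0 n1 triU) => //.
    by rewrite ed_exchange // exy ns orbT.
  have crjl : cr j l a c.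
    rewrite crC; case/orP: sm => /andP[/eqP-> /eqP->] //.
    by rewrite crCl.
  have /and4P[s1 s2 s3 s4] := side_not_diagonal cross sm.
  by apply: (quad_diagonal cross) => //; apply: nc.
move=> noquad; suff : quad_diagonals (polygon n) T [set a%:R; c%:R]%R [set b%:R; d%:R]%R.
  by rewrite noquad.
have [C|C] : cyc a b c d \/ cyc a d c b by move: cross; rewrite /cyc /cr; lia.
  apply/existsP; exists a%:R%R; apply/existsP; exists b%:R%R.
  apply/existsP; exists c%:R%R; apply/existsP; exists d%:R%R.
  by rewrite clockwise_natZ // C !eqxx /=; apply/and4P.
apply/existsP; exists a%:R%R; apply/existsP; exists d%:R%R.
apply/existsP; exists c%:R%R; apply/existsP; exists b%:R%R.
rewrite clockwise_natZ // C eqxx setUC eqxx /=; apply/and4P.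
by move: ab bc cd da; rewrite /ed; split; rewrite setUC.
Qed.

Lemma quad_exists i k : i < k -> k < n -> ed T i k ->
  [set i%:R; k%:R]%R \notin boundary (polygon n) ->
  exists j l, quad T i j k l.
Proof.
move=> ltik ltk eik; rewrite boundary_natZ // => nb.
have spl x y : x.+1 < y -> y < n -> ed T x y ->
  exists k, [/\ x < k, k < y, ed T x k & ed T k y] by apply: (@tri_split n T n1 triT 0).
have [|j [ltij ltjk eij ejk]] := spl i k _ ltk eik; first lia.
suff [l [ltl lout eil ekl]] : exists l, [/\ l < n, (l < i) || (k < l), ed T i l & ed T k l].
  exists j, l; split; rewrite ?eij ?ejk ?ekl ?(edC T l) ?eil //; first by lia.
  by rewrite /cr; lia.
(* The apex on the far side of {i, k} is found by descending from the base {0, n-1} through edges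
   {x, y} that enclose {i, k}, until {i, k} is a side of the triangle below {x, y}. *)
have outer d x y : y - x < d -> x <= i -> k <= y -> y < n -> (x != i) || (y != k) ->
    ed T x y -> exists l, [/\ l < n, (l < i) || (k < l), ed T i l & ed T k l].
  elim: d x y => // d IHd x y ltd lex ley lty ne exy.
  have [|z [ltxz ltzy exz ezy]] := spl x y _ lty exy; first lia.
  have [lezi|ltiz] := leqP z i.
    have [zyE|nzy] := boolP ((z == i) && (y == k)).
      case/andP: zyE => /eqP zE /eqP yE; subst z y.
      by exists x; rewrite !(edC T _ x); split=> //; lia.
    by apply: (IHd z y) => //; lia.
  have [lekz|ltzk] := leqP k z.
    have [zyE|nzy] := boolP ((x == i) && (z == k)).
      case/andP: zyE => /eqP xE /eqP zE; subst x z.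
      by exists y; split=> //; lia.
    by apply: (IHd x z) => //; lia.
  have := tri_nc0 n1 triT _ _ _ _ exz eik; have := tri_nc0 n1 triT _ _ _ _ ezy eik.
  by rewrite !cr_lt //; lia.
by apply: (outer n 0 n.-1); rewrite ?tri_base0 //; lia.
Qed.

Lemma flip_stepP U : flip_step (polygon n) T U <->
  exists a b c d, quad T a b c d /\ U = exchange T a b c d.
Proof.
split=> [/andP[_ /existsP[e /andP[]]]|[a [b [c [d [qT ->]]]]]].
  rewrite inE => /andP[nb eT] /eqP->.
  have [i [k [lti ltk ltik eE]]] := tri_edge n1 triT eT; subst e.
  have [j [l qT]] := quad_exists ltik ltk eT nb.
  by exists i, j, k, l; rewrite (flip_quad qT).
have [/and4P[lta ltb ltc ltd] cross ab cd ac] := qT.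
apply/andP; split=> //; apply/existsP; exists [set a%:R; c%:R]%R.
rewrite (flip_quad qT) eqxx inE [_ \in T]ac !andbT.
wlog ltac : a c cross lta ltc {qT ab cd ac} / a < c.
  move=> W; have [|] : a < c \/ c < a by move: cross; rewrite /cr; lia.
    exact: W.
  by rewrite setUC; apply: W; rewrite // crCl.
by rewrite boundary_natZ //; move: cross; rewrite /cr; lia.
Qed.

Lemma flip_step_tri U : flip_step (polygon n) T U -> triangulation (polygon n) U.
Proof. by move=> /flip_stepP[a [b [c [d [qT ->]]]]]; apply: tri_exchange. Qed.

(** By maximality of [U], some edge of [U] crosses {i, j}. It crosses no other edge of [T], so it is
    the second diagonal of the quadrilateral around {i, j}. Later flips are recognized by their only
    lost edge, without exhibiting a quadrilateral. *)
Lemma flip_step_of_diff U i j : triangulation (polygon n) U -> i < n -> j < n ->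
  ed T i j -> ~~ ed U i j ->
  (forall x y, x < n -> y < n -> x < y -> ed T x y -> ~~ same x y i j -> ed U x y) ->
  flip_step (polygon n) T U.
Proof.
move=> triU lti ltj eij neij sub.
wlog ltij : i j lti ltj eij neij sub / i < j.
  move=> W; have := tri_neq n1 triT lti ltj eij.
  case: (ltngtP i j) => // ltij _; first exact: (W i j).
  by apply: (W j i); rewrite // ?(edC _ j) // => *; apply: sub; rewrite // sameCr.
have sub' x y : x < n -> y < n -> ed T x y -> ~~ same x y i j -> ed U x y.
  move=> ltx lty exy ns; have := tri_neq n1 triT ltx lty exy.
  case: (ltngtP x y) => // lt _; first exact: sub.
  by rewrite edC; apply: sub => //; [rewrite edC | rewrite sameCl].
have nb : [set i%:R; j%:R]%R \notin boundary (polygon n).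
  rewrite boundary_natZ //; apply/negP => /orP[/eqP jE|/andP[/eqP iE /eqP jE]].
    by case/negP: neij; rewrite jE (tri_side0 n1 triU) // -jE.
  by case/negP: neij; rewrite iE jE (tri_base0 n1 triU).
have [k [l qT]] := quad_exists ltij ltj eij nb.
apply/flip_stepP; exists i, k, j, l; split=> //; have triE := tri_exchange qT.
have [/and4P[_ ltk _ ltl] cross /andP[ab bc] /andP[cd da] _] := qT.
apply/esym/tri_ext => // x y ltx lty _; rewrite ed_exchange //.
case/orP=> [sm|/andP[ns exy]]; last exact: sub'.
suff ekl : ed U k l by case/orP: sm => /andP[/eqP-> /eqP->] //; rewrite edC.
have [x' [y' [ltx' lty' exy crxy]]] :
    exists x' y', [/\ x' < n, y' < n, ed U x' y' & cr x' y' i j].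
  case: (boolP [exists x' : 'I_n, exists y' : 'I_n, ed U x' y' && cr x' y' i j]).
    by case/existsP=> x' /existsP[y' /andP[]]; exists x', y'.
  move=> /existsPn H; case/negP: neij; apply: (tri_max0 n1 triU) => //; first by lia.
  move=> k' l' ltk' ltl' _ e'; have /existsPn/(_ (Ordinal ltl')) := H (Ordinal ltk').
  by rewrite /= e' crC.
have nc u v : u < n -> v < n -> ed T u v -> ~~ same u v i j -> ~~ cr x' y' u v.
  by move=> ltu ltv euv ns; apply: (tri_nc0 n1 triU) => //; apply: sub'.
have : same x' y' k l.
  have sij : same i j i j by rewrite /same !eqxx.
  have /and4P[s1 s2 s3 s4] := side_not_diagonal cross sij.
  by apply: (quad_diagonal cross) => //; apply: nc.
by case/orP=> /andP[/eqP xE /eqP yE]; move: exy; rewrite xE yE // edC.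
Qed.

End Flip.

Lemma flip_step_sym n (T U : {set {set 'Z_n}}) : 1 < n ->
  flip_step (polygon n) T U -> flip_step (polygon n) U T.
Proof.
move=> n1 stepTU; have triT : triangulation (polygon n) T by case/andP: stepTU.
have triU := flip_step_tri n1 triT stepTU.
have [a [b [c [d [qT UE]]]]] := (flip_stepP n1 triT U).1 stepTU.
have [/and4P[lta ltb ltc ltd] cross _ _ ac] := qT; subst U.
apply: (flip_step_of_diff n1 triU triT ltb ltd).
- by rewrite ed_exchange // /same !eqxx.
- by apply/negP=> ebd; have := tri_nc0 n1 triT _ _ _ _ ac ebd; rewrite cross; lia.
by move=> x y ltx lty _; rewrite ed_exchange // => /orP[->//|/andP[]].
Qed.

(** * Connectedness of the flip graph *)

Ltac order_lia :=
  repeat match goal with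
  | H : context [ed _ _ _] |- _ => clear H
  | H : is_true (triangulation _ _) |- _ => clear H
  end; lia.

Definition is_fan n (T : {set {set 'Z_n}}) := forall j, 0 < j < n -> ed T 0 j.

Lemma fan_unique n (T U : {set {set 'Z_n}}) : 1 < n ->
  triangulation (polygon n) T -> triangulation (polygon n) U ->
  is_fan T -> is_fan U -> T = U.
Proof.
move=> n1 triT triU fanT fanU; apply: tri_ext => // i j lti ltj ltij eij.
have [i0|i0] := posnP i; first by subst; apply: fanU; lia.
have [jE|neji] := eqVneq j i.+1; first by rewrite jE (tri_side0 n1 triU) // -jE.
have := tri_nc0 n1 triT lti ltj _ _ eij (fanT i.+1 _).
by rewrite cr_lt //; lia.
Qed.

(** As long as vertex 0 is not joined to all others, some flip increases its degree. *)
Lemma connect_fan n (T : {set {set 'Z_n}}) : 1 < n -> triangulation (polygon n) T ->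
  exists F, [/\ triangulation (polygon n) F, is_fan F
    & connect (flip_step (polygon n)) T F].
Proof.
move=> n1.
pose deficit (U : {set {set 'Z_n}}) := #|[set j : 'I_n | (0 < j) && ~~ ed U 0 j]|.
have [d ltd] := ubnP (deficit T); elim: d T ltd => // d IHd T ltd triT.
case: (boolP [exists j : 'I_n, (0 < j) && ~~ ed T 0 j]) => [|/existsPn fanT].
  case/existsP=> -[j0 ltj0] /= nj0.
  (* With j the least non-neighbour of 0 and b the next neighbour after j, the vertices 0, j-1, b
     form a triangle; the flip of {j-1, b} joins 0 to the apex c on the other side. *)
  have [j /andP[j_gt0 nej] minj] := ex_minnP (ex_intro (fun j => (0 < j) && ~~ ed T 0 j) _ nj0).
  have ltjn : j < n by apply: leq_ltn_trans ltj0; apply: minj.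
  have lt1j : 1 < j.
    case: j j_gt0 nej {minj ltjn} => [//|[|//]] _.
    by rewrite (tri_side0 n1 triT).
  have eja : ed T 0 j.-1.
    by apply/negPn/negP => ne; have := minj j.-1; rewrite ne; lia.
  have base := tri_base0 n1 triT.
  have ltjb : j < n.-1.
    by rewrite ltn_neqAle; apply/andP; split; [apply: contra nej => /eqP-> | lia].
  have [b /andP[ltjb' eb] minb] := ex_minnP (ex_intro (fun b => (j < b) && ed T 0 b) n.-1
     (introT andP (conj ltjb base))).
  have ltbn : b < n by have := minb n.-1; rewrite ltjb base; lia.
  have eab : ed T j.-1 b.
    apply: tri_max0 => //; try lia.
    move=> k l ltk ltl ltkl ekl; apply/negP; rewrite cr_lt //; last by lia.
    have := tri_nc0 n1 triT _ _ _ _ eja ekl; have := tri_nc0 n1 triT _ _ _ _ eb ekl.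
    rewrite !cr_lt //; try lia.
    have [k0|k0] := posnP k; last by lia.
    have [lj|lj] := eqVneq l j; first by move: nej; rewrite -lj -k0 ekl.
    by have := minb l; rewrite -k0 ekl; lia.
  have [||c [ltac ltcb eac ecb]] := @tri_split n T n1 triT 0 j.-1 b _ _ eab; try order_lia.
  rewrite !add0n in eac ecb.
  have qT : quad T j.-1 0 b c.
    split; rewrite ?eab ?eb ?(edC T _ 0) ?eja ?(edC T _ c) ?ecb 1?edC ?eac //; try order_lia.
    by rewrite crC cr_lt; order_lia.
  have nec : ~~ ed T 0 c.
    apply/negP=> e0c; have := tri_nc0 n1 triT _ _ _ _ e0c eab.
    by rewrite cr_lt; order_lia.
  have triU := tri_exchange n1 triT qT.
  have edU i : 0 < i -> i < n -> ed (exchange T j.-1 0 b c) 0 i = (i == c) || ed T 0 i.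
    move=> i0 lti; rewrite ed_exchange //; try (clear -ltac ltcb ltbn; lia).
    have -> : same 0 i 0 c = (i == c) by clear -i0; rewrite /same; lia.
    by have -> : same 0 i j.-1 b = false by clear -lt1j ltjb'; rewrite /same; lia.
  have ltU : deficit (exchange T j.-1 0 b c) < d.
    rewrite ltnS in ltd; apply: leq_trans ltd; apply: proper_card; apply/properP; split.
      apply/subsetP=> -[i lti]; rewrite !inE /= => /andP[i0].
      by rewrite edU // negb_or i0 => /andP[].
    have ltcn : c < n by order_lia.
    have c0 : 0 < c by order_lia.
    by exists (Ordinal ltcn); rewrite !inE /= ?edU ?eqxx ?andbF // c0.
  have [F [triF fanF conF]] := IHd _ ltU triU.
  exists F; split=> //; apply: connect_trans conF; apply: connect1.
  by apply/flip_stepP => //; exists j.-1, 0, b, c.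
exists T; split=> // j /andP[j0 ltj].
by have := fanT (Ordinal ltj); rewrite /= j0 negbK.
Qed.

(** If no path existed, [delta] would be a default value and the maximum in [theta] would be
    empty. *)
Lemma flip_connected n (T U : {set {set 'Z_n}}) : 1 < n ->
  triangulation (polygon n) T -> triangulation (polygon n) U ->
  exists s, flip_path (polygon n) T U s.
Proof.
move=> n1 triT triU.
have [F [triF fanF conF]] := connect_fan n1 triT.
have [G [triG fanG conG]] := connect_fan n1 triU.
have csym : connect_sym (flip_step (polygon n)).
  by apply: sym_connect_sym => X Y; apply/idP/idP; apply: flip_step_sym.
rewrite (fan_unique n1 triF triG fanF fanG) in conF.
rewrite csym in conG; have /connectP[s ps ->] := connect_trans conF conG.
by exists s; rewrite /flip_path ps eqxx.
Qed.

(** * Deletion and the zigzag *)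

Lemma imset_set2 (aT rT : finType) (f : aT -> rT) a b :
  [set f x | x in [set a; b]] = [set f a; f b].
Proof. by rewrite imsetU !imset_set1. Qed.

(** * Vertex lists up to rotation *)

Section Rotation.

Variable V : eqType.
Implicit Types (p q : seq V) (x y : V).

Lemma rot_rot q i k : q != [::] ->
  exists2 j, j < size q & rot i (rot k q) = rot j q.
Proof.
move=> q0; have sq : 0 < size q by rewrite lt0n size_eq0.
suff [j ltj ->] : exists2 j, j <= size q & rot i (rot k q) = rot j q.
  have [lt|] := ltnP j (size q); first by exists j.
  by exists 0; rewrite // rot_oversize ?rot0.
have [lei|lti] := leqP i (size q); have [lek|ltk] := leqP k (size q).
- rewrite rot_add_mod //; case: ifP => h; first by exists (i + k).
  by exists (i + k - size q) => //; lia.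
- by exists i => //; rewrite (rot_oversize (ltnW ltk)).
- by exists k => //; rewrite rot_oversize // size_rot ltnW.
by exists 0; rewrite // rot_oversize ?size_rot 1?ltnW // rot_oversize ?rot0 // ltnW.
Qed.

Lemma filter_rot (P : pred V) k q :
  exists k', filter P (rot k q) = rot k' (filter P q).
Proof.
exists (size (filter P (take k q))).
have qE : filter P q = filter P (take k q) ++ filter P (drop k q).
  by rewrite -filter_cat cat_take_drop.
by rewrite qE rot_size_cat filter_cat.
Qed.

Lemma rem_rot x k q : uniq q -> exists k', rem x (rot k q) = rot k' (rem x q).
Proof.
move=> uq; rewrite !rem_filter ?rot_uniq //; exact: filter_rot.
Qed.

Lemma rem_mid q1 x q2 : uniq (q1 ++ x :: q2) -> rem x (q1 ++ x :: q2) = q1 ++ q2.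
Proof.
elim: q1 => [|y q1 IHq] /=; first by rewrite eqxx.
case/andP; rewrite mem_cat inE !negb_or => /and3P[_ /negPf-> _] /IHq->.
by [].
Qed.

Lemma next_mid q1 x y q2 : uniq (q1 ++ x :: y :: q2) ->
  next (q1 ++ x :: y :: q2) x = y.
Proof.
move=> uq; rewrite next_nth mem_cat inE eqxx orbT.
have ix : index x (q1 ++ x :: y :: q2) = size q1.
  rewrite index_cat /= eqxx addn0; case: ifP => // xq1.
  by move: uq; rewrite cat_uniq /= xq1 => /and3P[].
rewrite ix; case: q1 {uq ix} => //= z q1.
by rewrite nth_cat ltnNge leqnSn /= subSnn.
Qed.

End Rotation.

(** A label depends only on the position relative to [v], so the unknown rotation [k] disappears;
    [n - d] stands for minus [d] modulo [n]. *)
Lemma relabel_nth (V : finType) n (p q : seq V) k x0 d l i :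
  1 < n -> p = rot k q -> uniq q -> size q = n -> d < n -> i < n ->
  relabel n p (nth x0 q d) l (nth x0 q i) = (i + (n - d) + l)%:R%R.
Proof.
move=> n1 -> uq sq ltd lti; rewrite /relabel; set v := nth x0 q d.
have q0 : q != [::] by rewrite -size_eq0 sq; lia.
have vp : v \in rot k q by rewrite mem_rot mem_nth // sq.
have [j ltj rE] := rot_rot (index v (rot k q)) k q0.
have jd : j = d.
  have : nth x0 (rot j q) 0 = v by rewrite -rE rot_index.
  rewrite /rot nth_cat size_drop subn_gt0 ltj nth_drop addn0 => /eqP.
  by rewrite nth_uniq ?sq // -?sq // => /eqP.
rewrite rE jd; pose m := if d <= i then i - d else i + n - d.
have iE : nth x0 q i = nth x0 (rot d q) m.
  rewrite /rot nth_cat size_drop sq /m.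
  case: (leqP d i) => h; first by rewrite ifT ?nth_drop ?subnKC //; lia.
  by rewrite ifF ?nth_take; [congr nth; lia | lia | lia].
rewrite iE index_uniq ?rot_uniq // ?size_rot ?sq; last by rewrite /m; case: (leqP d i); lia.
rewrite /m; case: (leqP d i) => h; last by congr (_%:R)%R; lia.
by rewrite -(natZDn (i - d + l) n1); congr (_%:R)%R; lia.
Qed.

(** [S] is the image of [Z] under the contraction [g] of positions, edges that become loops being
    dropped; [c] and [c'] are the vertices at position 0 before and after. *)
Definition collapsed N n c c' (Z : {set {set 'Z_N}}) (S : {set {set 'Z_n}})
    (g : nat -> nat) :=
  forall e, e \in S <-> exists i j, [/\ i < N, j < N, ed Z (c + i) (c + j),
     g i != g j & e = [set (c' + g i)%:R; (c' + g j)%:R]%R].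

(** A deletion identifies [t] with its current successor [u], and the edge that it discards is the
    one that would become a loop; the contraction [g] is therefore followed by t |-> u. *)
Lemma collapsed_deletion N c (p : seq 'Z_N) (Z S : {set {set 'Z_N}}) g t u :
  1 < N -> t < N -> u < N -> t != u ->
  next p (c + t)%:R%R = (c + u)%:R%R -> (forall i, i < N -> g i < N) ->
  collapsed c c Z S g ->
  collapsed c c Z (deletion p (c + t)%:R%R S) (fun i => if g i == t then u else g i).
Proof.
move=> N1 ltt ltu netu nextE ltg colS e.
have img i j : i < N -> j < N ->
    [set if x == (c + t)%:R%R then (c + u)%:R%R else x
       | x in [set (c + g i)%:R%R; (c + g j)%:R%R]]
    = [set (c + (if g i == t then u else g i))%:R%R;
           (c + (if g j == t then u else g j))%:R%R] :> {set 'Z_N}.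
  move=> lti ltj; rewrite imset_set2 !eq_natZ_shift ?ltg //.
  by case: (g i == t); case: (g j == t).
have neE i j : i < N -> j < N ->
    [set (c + g i)%:R%R; (c + g j)%:R%R] == [set (c + t)%:R%R; (c + u)%:R%R] :> {set 'Z_N}
    = same (g i) (g j) t u.
  by move=> lti ltj; rewrite eq_set2 !eq_natZ_shift ?ltg.
rewrite /deletion nextE; split=> [/imsetP[e0] | [i [j [lti ltj eij neij ->]]]].
  rewrite !inE => /andP[ne0 /colS[i [j [lti ltj eij neij e0E]]]] ->.
  exists i, j; split=> //; last by rewrite e0E img.
  by move: ne0; rewrite e0E neE // /same; case: (g i =P t); case: (g j =P t); lia.
apply/imsetP; exists [set (c + g i)%:R%R; (c + g j)%:R%R]; last by rewrite img.
rewrite !inE neE //; apply/andP; split.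
  by move: neij; rewrite /same; case: (g i =P t); case: (g j =P t); lia.
apply/colS; exists i, j; split=> //.
by apply: contra neij => /eqP->.
Qed.

(** A monotone contraction sends triangles to triangles or to degenerate ones. If the apex below {i,
    j} is merged with an end, the search continues below the side that still has the image {x,
    y}. *)
Lemma tri_collapsed N n c c' (Z : {set {set 'Z_N}}) (S : {set {set 'Z_n}}) F :
  1 < N -> 1 < n -> triangulation (polygon N) Z ->
  (forall i, i < N -> F i < n) -> (forall i j, i <= j -> j < N -> F i <= F j) ->
  (forall i, i.+1 < N -> F i.+1 <= (F i).+1) ->
  F 0 = 0 -> F N.-1 = n.-1 -> collapsed c c' Z S F ->
  triangulation (polygon n) S.
Proof.
move=> N1 n1 triZ ltF monF stepF F0 FN colS.
have edS x y : x < y -> y < n -> ed S (c' + x) (c' + y) ->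
    exists i j, [/\ i < j, j < N, ed Z (c + i) (c + j), F i = x & F j = y].
  move=> ltxy lty /colS[i [j [lti ltj eij neij /eqP]]].
  have ltx := ltn_trans ltxy lty; rewrite eq_set2 !eq_natZ_shift ?ltF //.
  case/orP=> /andP[/eqP xE /eqP yE].
    exists i, j; split=> //; case: (ltngtP i j) => // h.
      by have := monF j i; lia.
    by move: neij; rewrite h eqxx.
  exists j, i; rewrite edC; split=> //; case: (ltngtP i j) => // h.
    by have := monF i j; lia.
  by move: neij; rewrite h eqxx.
have inS i j : i < N -> j < N -> ed Z (c + i) (c + j) -> F i != F j ->
    ed S (c' + F i) (c' + F j).
  by move=> lti ltj eij ne; apply/colS; exists i, j.
apply: (@tri_of_split n c') => //.
- move=> e /colS[i [j [lti ltj _ ne ->]]].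
  have := ltF i lti; have := ltF j ltj.
  case: (ltngtP (F i) (F j)) ne => // lt _ h1 h2; first by exists (F i), (F j).
  by exists (F j), (F i); rewrite setUC.
- rewrite -FN -F0; apply: inS; try lia; first exact: tri_base.
- move=> x y z w /andP[ltxz ltzy] /andP[ltyw ltw] exy ezw.
  have [||i [j [ltij ltj eij iE jE]]] := edS x y _ _ exy; try lia.
  have [||k [l [ltkl ltl ekl kE lE]]] := edS z w _ _ ezw; try lia.
  have lt1 a b : a < N -> F a < F b -> a < b.
    by move=> lta ltab; rewrite ltnNge; apply/negP=> leba; have := monF b a leba lta; lia.
  have h1 : i < k by apply: lt1; lia.
  have h2 : k < j by apply: lt1; lia.
  have h3 : j < l by apply: lt1; lia.
  have := tri_nc N1 triZ _ _ _ _ eij ekl.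
  by rewrite cr_lt // h1 h2 h3; lia.
move=> x y ltxy lty exy.
have [||i [j [ltij ltj eij iE jE]]] := edS x y _ _ exy; try lia.
have [d ltd] := ubnP (j - i).
elim: d i j ltd ltij ltj eij iE jE => // d IHd i j ltd ltij ltj eij iE jE.
(* [F] grows by at most one per step, whereas the images of i and j are at least two apart. *)
have ij1 : i.+1 < j.
  rewrite ltn_neqAle ltij andbT; apply/eqP => jE'; have := stepF i; rewrite jE' iE jE.
  by move=> /(_ ltj); lia.
have [k [ltik ltkj eik ekj]] := tri_split N1 triZ ij1 ltj eij.
have lexk := monF i k (ltnW ltik) (ltn_trans ltkj ltj).
have leky := monF k j (ltnW ltkj) ltj.
have [kx|nkx] := eqVneq (F k) x; first by apply: (IHd k j) => //; lia.
have [ky|nky] := eqVneq (F k) y; first by apply: (IHd i k) => //; lia.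
exists (F k); split; [lia | lia | rewrite -iE | rewrite -jE]; apply: inS => //; lia.
Qed.

(** * The zigzag in coordinates counted from vertex 3 *)

Lemma next_polygonE n (x : 'Z_n) : 1 < n -> next (polygon n) x = (x + 1)%R.
Proof.
by move=> n1; have [i lti ->] := natZP x n1; rewrite next_polygon // -natr1.
Qed.

(** Counted from vertex 3, the zigzag edge of index 2k+1 joins positions 1+k and N-1-k, and the one
    of index 2k+2 joins 1+k and N-2-k. Hence inner edges are recognized by the sum N or N-1; the
    disjuncts also cover the sides. *)
Definition zz N a b := [|| b == a.+1, a + b == N | a + b == N.-1].

Lemma zigzag_edgeE N i : 1 < N -> i < N - 3 ->
  zigzag_edge N i.+1 =
  [set (3 + (1 + i./2))%:R; (3 + (N.-1 - uphalf i))%:R]%R.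
Proof.
move=> N1 lti; rewrite /zigzag_edge /= uphalf_half.
have subE m k : k <= N -> (m%:R - k%:R = (m + (N - k))%:R :> 'Z_N)%R.
  move=> lek; apply/eqP; rewrite subr_eq -natrD -(natZDn m N1).
  by apply/eqP; congr (_%:R)%R; lia.
case: (boolP (odd i)) => oi /=.
  have -> : (1 - (i./2)%:R)%R = (1%:R - (i./2)%:R)%R :> 'Z_N by [].
  rewrite setUC -natrD subE; last by lia.
  by congr [set _; _]; congr (_%:R)%R; lia.
rewrite setUC -natrD subE; last by lia.
by congr [set _; _]; congr (_%:R)%R; lia.
Qed.

Lemma zigzagP N e : 3 < N -> e \in zigzag N <->
  exists a b, [/\ a < b, b < N, zz N a b & e = [set (3 + a)%:R; (3 + b)%:R]%R].
Proof.
move=> N3; have N1 : 1 < N by lia.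
have wrap : (3 + N)%:R%R = (3 + 0)%:R%R :> 'Z_N by rewrite addnC natZDn.
have side i : i < N -> next (polygon N) (3 + i)%:R%R = (3 + i.+1)%:R%R.
  by move=> lti; rewrite next_polygonE // addnS -natr1.
rewrite in_setU; split=> [/orP[/imsetP[x _ ->]|/imsetP[[i lti] _ ->]] /=|].
- have [i lti ->] := natZ_shiftP 3 x N1; rewrite side //.
  have [lt|le] := ltnP i.+1 N; first by exists i, i.+1; rewrite /zz eqxx.
  exists 0, i; have -> : i.+1 = N by lia.
  by rewrite wrap setUC; split=> //; rewrite /zz; lia.
- rewrite zigzag_edgeE //; exists (1 + i./2), (N.-1 - uphalf i).
  by rewrite uphalf_half /zz; split=> //; lia.
move=> [a [b [ltab ltb zab ->]]]; apply/orP.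
have [bE|nb] := eqVneq b a.+1.
  left; apply/imsetP; exists (3 + a)%:R%R; first exact: mem_polygon.
  by rewrite side ?bE //; lia.
have [a0|a0] := posnP a.
  left; apply/imsetP; exists (3 + b)%:R%R; first exact: mem_polygon.
  rewrite side // setUC a0; have -> : b.+1 = N by move: zab nb; rewrite /zz; lia.
  by rewrite wrap.
(* The zero-based index of the edge: k is a-1, and the sum N-1 marks the second edge of the k-th
   pair. *)
right; have lti : (a.-1).*2 + (a + b == N.-1) < N - 3 by move: zab nb; rewrite /zz; lia.
apply/imsetP; exists (Ordinal lti) => //; rewrite zigzag_edgeE //=.
by congr [set _; _]; congr (_%:R)%R; move: zab nb; rewrite /zz ?uphalf_half; lia.
Qed.

Lemma ed_zigzag N a b : 3 < N -> a < b -> b < N ->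
  ed (zigzag N) (3 + a) (3 + b) = zz N a b.
Proof.
move=> N3 ltab ltb; have N1 : 1 < N by lia.
apply/idP/idP => [/zigzagP[//|i [j [ltij ltj zij /eqP]]]|zab].
  by rewrite eq_set2 !eq_natZ_shift //; move: zij; rewrite /zz; lia.
by apply/zigzagP => //; exists a, b.
Qed.

(** The apex below {i, j} is j-1 when the sum is N and i+1 when it is N-1: each choice leads to an
    edge of the other kind and a side. *)
Lemma tri_zigzag N : 3 < N -> triangulation (polygon N) (zigzag N).
Proof.
move=> N3; apply: (@tri_of_split N 3); try lia.
- by move=> e /zigzagP[//|a [b [ltab ltb _ ->]]]; exists a, b.
- by rewrite ed_zigzag /zz //; lia.
- move=> i j k l /andP[ik kj] /andP[jl ltl]; rewrite !ed_zigzag /zz //; lia.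
move=> i j ltij ltj; rewrite ed_zigzag //; last by lia.
move=> zij; have [sN|sN] := eqVneq (i + j) N.
  by exists j.-1; rewrite !ed_zigzag /zz //; try lia; split; lia.
exists i.+1; rewrite !ed_zigzag /zz //; try lia; move: zij; rewrite /zz; split; lia.
Qed.

(* Deleting 0, 1, M and M+1 collapses 0, 1, 2 to one vertex and M, M+1, M+2 to
   another one. *)
Definition collapse M i :=
  if i <= 2 then 0 else if i <= M then i - 2 else if i <= M.+2 then M - 2 else i - 4.

(* The vertex at position [i] once 0, 1, M and M+1 are deleted. *)
Definition survivor M i := if i < M - 2 then i + 2 else i + 4.

(** The left-hand side is the composite of four contractions in the form in which
    [collapsed_deletion] yields them. *)
Lemma survivor_collapse M i : 5 < M ->
  let i1 := if i == 0 then 1 else i in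
  let i2 := if i1 == 1 then 2 else i1 in
  let i3 := if i2 == M then M.+1 else i2 in
  (if i3 == M.+1 then M.+2 else i3) = survivor M (collapse M i).
Proof.
move=> M5 i1 i2 i3; rewrite /i3 /survivor /collapse.
have -> : i2 = if i <= 2 then 2 else i.
  by rewrite /i2 /i1; case: (i) => [|[|[|]]].
clear i1 i2 i3; case: (leqP i 2) => h2.
  rewrite subn_gt0; do ?case: ifP; lia.
by case: (leqP i M) => hM; [|case: (leqP i M.+2) => hM2]; do ?case: ifP; lia.
Qed.

Lemma survivor_inj M i j : survivor M i = survivor M j -> i = j.
Proof. by rewrite /survivor; case: (ltnP i _); case: (ltnP j _); lia. Qed.

Lemma collapse_lt n i : 7 < n -> i < n + 4 -> collapse (n + 4)./2 i < n.
Proof.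
by move=> n7 lti; rewrite /collapse; do 3?case: ifP => ?; lia.
Qed.

Lemma iota_split M N : 5 < M -> M.+3 <= N -> iota 0 N =
  [:: 0; 1; 2] ++ iota 3 (M - 3) ++ [:: M; M.+1; M.+2] ++ iota M.+3 (N - M.+3).
Proof.
move=> ltM leN; have {1}-> : N = 3 + ((M - 3) + (3 + (N - M.+3))) by lia.
rewrite iotaD iotaD [in X in _ ++ _ ++ X]iotaD !add0n.
have -> : 3 + (M - 3) = M by lia.
by rewrite addn3.
Qed.

(** This serves both triangulations of the pair A, with [c] equal to 0 and to 4. The vertex that
    receives label [l] is the survivor of rank [d], and [c'] is the label that then falls on rank
    0. *)
Lemma collapsed_delete4 n c l d c' : 7 < n -> let N := n + 4 in let M := N./2 in
  c <= N -> d < n -> ((n - d + l)%:R = c'%:R :> 'Z_n)%R ->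
  let pT := foldl (@delete 'Z_N) (polygon N, zigzag N)
    [:: (c + 0)%:R; (c + 1)%:R; (c + M)%:R; (c + M.+1)%:R]%R in
  let v := (c + survivor M d)%:R%R in
  collapsed c c' (zigzag N) (relabel_triang n pT.1 v l pT.2) (collapse M).
Proof.
move=> n7 N M leN ltd labE pT v.
have M5 : 5 < M by rewrite /M /N; lia.
have MN : M.+3 <= N by rewrite /M /N; lia.
have N1 : 1 < N by rewrite /N; lia.
pose vt i : 'Z_N := (c + i)%:R%R.
set L := iota 3 (M - 3); set K := iota M.+3 (N - M.+3).
have LK : iota 0 N = [:: 0; 1; 2] ++ L ++ [:: M; M.+1; M.+2] ++ K by exact: iota_split.
have uq : uniq (map vt (iota 0 N)).
  rewrite map_inj_in_uniq ?iota_uniq // => i j; rewrite !mem_iota /vt => lti ltj /eqP.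
  by rewrite eq_natZ_shift //; lia.
have [k0 p0] : exists k, polygon N = rot k (map vt (iota 0 N)).
  exists (N - c); rewrite -rot_polygon // -[LHS](rotK c) /rotr size_rot.
  by rewrite size_polygon.
(* One deletion, where [u] comes right after [t] in the current list of positions; the list itself
   is known only up to a rotation. *)
have del p k l1 t u l2 S g :
    p = rot k (map vt (l1 ++ t :: u :: l2)) -> uniq (map vt (l1 ++ t :: u :: l2)) ->
    t < N -> u < N -> t != u -> (forall i, i < N -> g i < N) ->
    collapsed c c (zigzag N) S g ->
    [/\ exists k, (delete (p, S) (vt t)).1 = rot k (map vt (l1 ++ u :: l2)),
        uniq (map vt (l1 ++ u :: l2)),
        forall i, i < N -> (if g i == t then u else g i) < N &
        collapsed c c (zigzag N) (delete (p, S) (vt t)).2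
          (fun i => if g i == t then u else g i)].
  move=> pE up ltt ltu netu ltg colS; split.
  - rewrite /= pE; have [k' ->] := rem_rot (vt t) k up.
    by exists k'; move: up; rewrite !map_cat => up; rewrite rem_mid.
  - apply: subseq_uniq up; apply: map_subseq; apply: cat_subseq => //.
    exact: subseq_cons.
  - by move=> i lti; case: ifP => // _; apply: ltg.
  apply: collapsed_deletion => //.
  by rewrite pE next_rot // map_cat; move: up; rewrite map_cat => up; rewrite next_mid.
have col0 : collapsed c c (zigzag N) (zigzag N) id.
  have triZ : triangulation (polygon N) (zigzag N) by apply: tri_zigzag; lia.
  have [edZ _] := (triangulation_shiftP c _ N1).1 triZ.
  move=> e; split=> [eZ|[i [j [_ _ + _ ->]]] //].
  by have [i [j [lti ltj ne eE]]] := edZ e eZ; exists i, j; split=> //; rewrite /ed -eE.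
rewrite LK in p0 uq.
have lt1 : 1 < N by lia. have lt2 : 2 < N by lia.
have [[k1 p1] u1 g1 col1] := del _ k0 [::] 0 1 _ _ _ p0 uq (ltnW N1) lt1 isT (fun i h => h) col0.
have [[k2 p2] u2 g2 col2] := del _ k1 [::] 1 2 _ _ _ p1 u1 lt1 lt2 isT g1 col1.
have ltM : M < N by lia. have ltM1 : M.+1 < N by lia. have ltM2 : M.+2 < N by lia.
have ne1 : M != M.+1 by lia. have ne2 : M.+1 != M.+2 by lia.
have [[k3 p3] u3 g3 col3] :=
  del _ k2 (2 :: L) M M.+1 (M.+2 :: K) _ _ p2 u2 ltM ltM1 ne1 g2 col2.
have [[k4 p4] u4 g4 col4] :=
  del _ k3 (2 :: L) M.+1 M.+2 K _ _ p3 u3 ltM1 ltM2 ne2 g3 col3.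
set q := (2 :: L) ++ M.+2 :: K in p4 u4.
have qE : q = iota 2 (M - 2) ++ iota M.+2 (N - M.+2).
  have -> : M - 2 = (M - 3).+1 by lia.
  by have -> : N - M.+2 = (N - M.+3).+1 by lia.
have sq : size (map vt q) = n.
  by rewrite size_map qE size_cat !size_iota /N; lia.
have nthq i : i < n -> vt (survivor M i) = nth 0%R (map vt q) i.
  move=> lti; rewrite (nth_map 0); last by rewrite -sq size_map in lti.
  rewrite qE nth_cat size_iota /survivor; case: ltnP => h.
    by rewrite nth_iota // addnC.
  by rewrite nth_iota /N; [congr vt; lia | lia].
have n1 : 1 < n by lia.
have lab i : i < N ->
    relabel n pT.1 v l (vt (survivor M (collapse M i))) = (c' + collapse M i)%:R%R.
  move=> lti; have ltc := collapse_lt n7 lti.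
  rewrite {1}/v -/(vt _) !nthq // (relabel_nth 0%R l n1 p4 u4 sq) //.
  by rewrite -addnA natrD labE natrD addrC.
have lab2 i j : i < N -> j < N -> [set relabel n pT.1 v l x
    | x in [set vt (survivor M (collapse M i)); vt (survivor M (collapse M j))]]
    = [set (c' + collapse M i)%:R; (c' + collapse M j)%:R]%R.
  by move=> lti ltj; rewrite imset_set2 !lab.
move=> e; split=> [/imsetP[e0 /col4[i [j [lti ltj eij ne ->]]] ->]|].
  exists i, j; rewrite !survivor_collapse // in ne *; split=> //; last exact: lab2.
  by apply: contra ne => /eqP->.
move=> [i [j [lti ltj eij ne ->]]].
apply/imsetP; exists [set vt (survivor M (collapse M i)); vt (survivor M (collapse M j))];
  last by rewrite lab2.
apply/col4; exists i, j; rewrite !survivor_collapse //; split=> //.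
by apply: contra ne => /eqP/survivor_inj->.
Qed.

(** * The pair A as contracted zigzags *)

Lemma A_minus_collapsed n : 7 < n ->
  collapsed 0 2 (zigzag (n + 4)) (A_minus n) (collapse (n + 4)./2).
Proof.
move=> n7; have := @collapsed_delete4 n 0 2 0 2 n7 isT.
rewrite subn0 natZDn; last by lia.
move=> /(_ _ erefl); rewrite /A_minus /bar !add0n.
have -> : survivor (n + 4)./2 0 = 2 by rewrite /survivor ifT //; lia.
by rewrite nat1r add0r; apply; lia.
Qed.

(** Counted from vertex 4, vertex 2 is at position n+2 and has rank n-2 among the survivors; label 1
    for it puts label 3 on rank 0. *)
Lemma A_plus_collapsed n : 7 < n ->
  collapsed 4 3 (zigzag (n + 4)) (A_plus n) (collapse (n + 4)./2).
Proof.
move=> n7; have := @collapsed_delete4 n 4 1 (n - 2) 3 n7; cbv zeta.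
have -> : survivor (n + 4)./2 (n - 2) = n + 2 by rewrite /survivor ifF; lia.
have -> : 4 + (n + 2) = (n + 4) + 2 by lia.
rewrite natZDn; last by lia.
have -> : 4 + (n + 4)./2.+1 = 5 + (n + 4)./2 by lia.
have lab : (n - (n - 2) + 1)%:R%R = 3%:R%R :> 'Z_n by congr (_%:R)%R; lia.
by rewrite /A_plus /bar -!natrD; apply; rewrite ?lab //; lia.
Qed.

Section Collapse.

Variable n : nat.
Hypothesis n7 : 7 < n.
Let M := (n + 4)./2.

Lemma collapse_mono i j : i <= j -> j < n + 4 -> collapse M i <= collapse M j.
Proof. by move=> leij ltj; rewrite /collapse /M; do 6?case: ifP => ?; lia. Qed.

Lemma collapse_step i : collapse M i.+1 <= (collapse M i).+1.
Proof. by rewrite /collapse /M; do 6?case: ifP => ?; lia. Qed.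

Lemma collapse_last : collapse M (n + 4).-1 = n.-1.
Proof. by rewrite /collapse /M; do 3?case: ifP => ?; lia. Qed.

Lemma tri_collapse_zigzag c c' (S : {set {set 'Z_n}}) :
  collapsed c c' (zigzag (n + 4)) S (collapse M) -> triangulation (polygon n) S.
Proof.
apply: tri_collapsed; try lia; first by apply: tri_zigzag; lia.
- by move=> i lti; apply: collapse_lt.
- exact: collapse_mono.
- by move=> i _; apply: collapse_step.
- by [].
exact: collapse_last.
Qed.

Lemma tri_A_minus : triangulation (polygon n) (A_minus n).
Proof. exact: tri_collapse_zigzag (A_minus_collapsed n7). Qed.

Lemma tri_A_plus : triangulation (polygon n) (A_plus n).
Proof. exact: tri_collapse_zigzag (A_plus_collapsed n7). Qed.

Lemma ed_A_minus i j : i < n + 4 -> j < n + 4 -> ed (zigzag (n + 4)) i j ->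
  collapse M i != collapse M j -> ed (A_minus n) (2 + collapse M i) (2 + collapse M j).
Proof. by move=> lti ltj eij ne; apply/(A_minus_collapsed n7); exists i, j. Qed.

(** These are the images of the zigzag edges {2,4}, {1,5}, {0,6} and {-1,6}: the vertices 0, 1, 2
    merge into the one labeled 2. As n > 7, [M] is at least 6 and 4, 5, 6 stay distinct. *)
Lemma A_minus_edges :
  [/\ ed (A_minus n) 2 4, ed (A_minus n) 2 5, ed (A_minus n) 2 6
    & ed (A_minus n) 1 6].
Proof.
have c0 i : i <= 2 -> collapse M i = 0 by rewrite /collapse => ->.
have cm i : 2 < i -> i <= M -> collapse M i = i - 2.
  by rewrite /collapse ltnNge => /negPf-> ->.
have M5 : 6 <= M by rewrite /M; lia.
have N1 : 1 < n + 4 by lia.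
have sh i : (n + 4 + i)%:R%R = i%:R%R :> 'Z_(n + 4) by rewrite natZDn.
have zE a b : a < b -> b < n + 4 -> zz (n + 4) a b -> ed (zigzag (n + 4)) (3 + a) (3 + b).
  by move=> *; rewrite ed_zigzag //; lia.
have := zE 1 (n + 3); have := zE 2 (n + 2); have := zE 3 (n + 1); have := zE 3 n.
rewrite /zz /ed.
have -> : 3 + (n + 3) = n + 4 + 2 by lia.
have -> : 3 + (n + 2) = n + 4 + 1 by lia.
have -> : 3 + (n + 1) = n + 4 + 0 by lia.
rewrite !sh => h1 h2 h3 h4; split.
- have := @ed_A_minus 2 4; rewrite c0 // cm //; try lia; apply; try lia.
  by rewrite edC; apply: h4; lia.
- have := @ed_A_minus 1 5; rewrite c0 // cm //; try lia; apply; try lia.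
  by rewrite edC; apply: h3; lia.
- have := @ed_A_minus 0 6; rewrite c0 // cm //; try lia; apply; try lia.
  by rewrite edC; apply: h2; lia.
have := @ed_A_minus (n + 4).-1 6; rewrite collapse_last cm //.
have -> : 2 + n.-1 = n + 1 by lia.
have -> : ed (A_minus n) (n + 1) (2 + (6 - 2)) = ed (A_minus n) 1 6.
  by rewrite /ed natZDn //; lia.
apply; try lia.
have -> : (n + 4).-1 = 3 + n by lia.
by rewrite edC; apply: h1; lia.
Qed.

(** The image of the zigzag edge {2,4}, whose ends have positions n+2 and 0 when counted from vertex
    4. *)
Lemma A_plus_edge : ed (A_plus n) 1 3.
Proof.
have N1 : 1 < n + 4 by lia.
have e02 : ed (zigzag (n + 4)) (4 + (n + 2)) (4 + 0).
  have : ed (zigzag (n + 4)) (3 + 1) (3 + (n + 3)) by rewrite ed_zigzag /zz //; lia.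
  have -> : 3 + (n + 3) = 4 + (n + 2) by lia.
  by rewrite edC.
have cE : collapse M (n + 2) = n - 2 by rewrite /collapse /M; do 3?case: ifP => ?; lia.
have : ed (A_plus n) (3 + collapse M (n + 2)) (3 + collapse M 0).
  apply/(A_plus_collapsed n7); exists (n + 2), 0; split=> //; try lia.
  by rewrite -/M cE /collapse /=; lia.
rewrite cE; have -> : 3 + (n - 2) = n + 1 by lia.
by rewrite /ed natZDn //; lia.
Qed.

End Collapse.

(** * Filling the hexagon 1, ..., 6 *)

Definition edge_set n (R : rel nat) : {set {set 'Z_n}} :=
  [set e | [exists x : 'Z_n, exists y : 'Z_n, [&& x < y, R x y & e == [set x; y]]]].

Lemma edge_setP n (R : rel nat) e : 1 < n -> e \in edge_set n R <->
  exists i j, [/\ i < j, j < n, R i j & e = [set i%:R; j%:R]%R].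
Proof.
move=> n1; rewrite inE; split.
  case/existsP=> x /existsP[y]; have [i lti ->] := natZP x n1.
  have [j ltj ->] := natZP y n1; rewrite !natZ_small // => /and3P[ltij Rij /eqP->].
  by exists i, j.
move=> [i [j [ltij ltj Rij ->]]]; apply/existsP; exists i%:R%R.
apply/existsP; exists j%:R%R; rewrite !natZ_small //; last exact: ltn_trans ltj.
by rewrite ltij Rij eqxx.
Qed.

Lemma ed_edge_set n (R : rel nat) i j : 1 < n -> i < n -> j < n ->
  (forall x, R x x = false) -> (forall x y, R x y = R y x) ->
  ed (edge_set n R) i j = R i j.
Proof.
move=> n1 lti ltj irrR symR; apply/idP/idP => [/edge_setP[//|k [l [ltkl ltl Rkl /eqP]]]|Rij].
  rewrite eq_set2_natZ //; last exact: ltn_trans ltl.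
  by case/orP=> /andP[/eqP-> /eqP->]; rewrite // symR.
apply/edge_setP => //; case: (ltngtP i j) => ltij; first by exists i, j.
  by exists j, i; rewrite symR setUC.
by rewrite ltij irrR in Rij.
Qed.

Lemma tri_edge_set n (R : rel nat) : 1 < n ->
  (forall x, R x x = false) -> (forall x y, R x y = R y x) ->
  (forall i j k l, i < j -> j < n -> k < l -> l < n -> R i j -> R k l -> ~~ cr i j k l) ->
  (forall i j, i < j -> j < n ->
    (forall k l, k < l -> l < n -> R k l -> ~~ cr i j k l) -> R i j) ->
  triangulation (polygon n) (edge_set n R).
Proof.
move=> n1 irrR symR ncR maxR; apply/(triangulation_shiftP 0) => //; split.
  move=> e /edge_setP[//|i [j [ltij ltj _ ->]]].
  by exists i, j; rewrite neq_ltn ltij ltj; split=> //; exact: ltn_trans ltj.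
have nc i j k l : i < n -> j < n -> k < n -> l < n -> R i j -> R k l -> ~~ cr i j k l.
  move=> lti ltj ltk ltl; case: (ltngtP i j) => [ltij|ltji|->]; last by rewrite irrR.
    case: (ltngtP k l) => [ltkl|ltlk|->]; last by rewrite irrR.
      exact: ncR.
    by rewrite (symR k) crCr; apply: ncR.
  case: (ltngtP k l) => [ltkl|ltlk|->]; last by rewrite irrR.
    by rewrite (symR i) crCl; apply: ncR.
  by rewrite (symR i) (symR k) crCl crCr; apply: ncR.
move=> i j lti ltj; rewrite !add0n ed_edge_set //; split=> [Rij|[neij ncij]].
  split=> [|k l ltk ltl]; first by apply: contraTneq Rij => ->; rewrite irrR.
  by rewrite !add0n ed_edge_set //; apply: nc.
have {}ncij k l : k < l -> l < n -> R k l -> ~~ cr i j k l.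
  by move=> ltkl ltl Rkl; have ltk := ltn_trans ltkl ltl; apply: ncij; rewrite ?add0n ?ed_edge_set.
case: (ltngtP i j) neij => // lt _; first exact: maxR.
by rewrite symR; apply: maxR => // k l ltkl ltl Rkl; rewrite crCl; apply: ncij.
Qed.

(* The triangulation of the hexagon 1, ..., 6 with inner edges {1,3}, {3,6} and
   either {3,5} or {4,6}. *)
Definition hexagon (w : bool) i j :=
  [|| same i j 1 6, same i j 1 3, same i j 3 6,
      (if w then same i j 3 5 else same i j 4 6), j == i.+1 | i == j.+1].

Definition inhex i j := [&& 0 < i, i < 7, 0 < j & j < 7].

Lemma hexagonC w i j : hexagon w i j = hexagon w j i.
Proof. by rewrite /hexagon !(sameCl i) [(j == _) || _]orbC. Qed.

Lemma hexagon_nc w i j k l : inhex i j -> inhex k l ->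
  hexagon w i j -> hexagon w k l -> ~~ cr i j k l.
Proof.
case/and4P=> i0 i7 j0 j7 /and4P[k0 k7 l0 l7].
have H : all (fun i => all (fun j => all (fun k => all (fun l =>
   hexagon w i j ==> hexagon w k l ==> ~~ cr i j k l)
   (iota 1 6)) (iota 1 6)) (iota 1 6)) (iota 1 6) by case: w; vm_compute.
have inI x : 0 < x -> x < 7 -> x \in iota 1 6 by rewrite mem_iota => -> ->.
have /allP/(_ _ (inI _ j0 j7))/allP/(_ _ (inI _ k0 k7)) := allP H _ (inI _ i0 i7).
by move=> /allP/(_ _ (inI _ l0 l7))/implyP h1 /h1/implyP.
Qed.

Lemma hexagon_max w i j : inhex i j -> i < j ->
  (forall k l, inhex k l -> k < l -> hexagon w k l -> ~~ cr i j k l) -> hexagon w i j.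
Proof.
case/and4P=> i0 i7 j0 j7 ltij nc.
have H : all (fun i => all (fun j => (i < j) ==>
   all (fun k => all (fun l => (k < l) ==> hexagon w k l ==> ~~ cr i j k l)
     (iota 1 6)) (iota 1 6) ==> hexagon w i j) (iota 1 6)) (iota 1 6).
  by case: w {nc}; vm_compute.
have inI x : 0 < x -> x < 7 -> x \in iota 1 6 by rewrite mem_iota => -> ->.
have /allP/(_ _ (inI _ j0 j7)) := allP H _ (inI _ i0 i7).
rewrite ltij => /implyP/(_ isT)/implyP; apply; apply/allP => k; rewrite mem_iota => /andP[k0 k7].
apply/allP => l; rewrite mem_iota => /andP[l0 l7].
by apply/implyP=> ltkl; apply/implyP; apply: nc => //; rewrite /inhex k0 k7 l0.
Qed.

Section Hexagon.

Variable n : nat.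
Hypothesis n6 : 6 < n.
Implicit Types (T U : {set {set 'Z_n}}) (w : bool).

Let n1 : 1 < n. Proof. exact: leq_trans n6. Qed.
Let l2 : 2 < n. Proof. exact: leq_trans n6. Qed.
Let l3 : 3 < n. Proof. exact: leq_trans n6. Qed.
Let l4 : 4 < n. Proof. exact: leq_trans n6. Qed.
Let l5 : 5 < n. Proof. exact: leq_trans n6. Qed.

Definition hex_rel w T : rel nat := fun i j =>
  (i != j) && (if inhex i j then hexagon w i j else ed T i j).

Definition hex_fill w T := edge_set n (hex_rel w T).

Lemma ed_hex_fill w T i j : i < n -> j < n -> i != j -> ed (hex_fill w T) i j =
  if inhex i j then hexagon w i j else ed T i j.
Proof.
move=> lti ltj ne; rewrite ed_edge_set // /hex_rel ?ne // => [x|x y].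
  by rewrite eqxx.
rewrite eq_sym edC; have -> : inhex x y = inhex y x by rewrite /inhex; lia.
suff -> : hexagon w x y = hexagon w y x by [].
exact: hexagonC.
Qed.

(* A chord can enter the hexagon only through its side {1,6}. *)
Lemma outside_hex i j k l : i < j -> ~~ inhex i j -> ~~ cr i j 1 6 -> k < l ->
  inhex k l -> ~~ cr i j k l.
Proof. by move=> ltij nin + ltkl inkl; rewrite !cr_lt //; move: nin inkl; rewrite /inhex; lia. Qed.

(** Since {1,6} is an edge of [T], no edge of [T] enters the hexagon from outside, and the two sides
    of {1,6} are triangulated independently. *)
Lemma tri_hex_fill w T : triangulation (polygon n) T -> ed T 1 6 ->
  triangulation (polygon n) (hex_fill w T).
Proof.
move=> triT e16.
have R16 : hex_rel w T 1 6 by [].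
apply: tri_edge_set => //.
- by move=> x; rewrite /hex_rel eqxx.
- move=> x y; rewrite /hex_rel eq_sym edC; have -> : inhex x y = inhex y x by rewrite /inhex; lia.
  suff -> : hexagon w x y = hexagon w y x by [].
  exact: hexagonC.
- move=> i j k l ltij ltj ltkl ltl; have lti := ltn_trans ltij ltj.
  have ltk := ltn_trans ltkl ltl.
  rewrite /hex_rel !neq_ltn ltij ltkl /=.
  case: ifP => inij; case: ifP => inkl.
  + exact: hexagon_nc.
  + move=> _ ekl; rewrite crC; apply: outside_hex => //; first by rewrite inkl.
    exact: (tri_nc0 n1 triT).
  + move=> eij _; apply: outside_hex => //; first by rewrite inij.
    exact: (tri_nc0 n1 triT).
  exact: (tri_nc0 n1 triT).
move=> i j ltij ltj nc; rewrite /hex_rel neq_ltn ltij /=; case: ifP => inij.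
  apply: hexagon_max => // k l inkl ltkl hkl; apply: nc => //;
    last by rewrite /hex_rel neq_ltn ltkl inkl.
  by case/and4P: inkl => _ _ _ l7; apply: leq_trans n6.
apply: (tri_max0 n1 triT) => //; [exact: ltn_trans ltj | by rewrite neq_ltn ltij |].
move=> k l ltk ltl ltkl ekl; have [inkl|nin] := boolP (inhex k l).
  by apply: outside_hex; rewrite ?inij //; apply: nc.
by apply: nc => //; rewrite /hex_rel neq_ltn ltkl (negPf nin).
Qed.

(** A potential that bounds from below the number of flips inside the hexagon; it starts at 3. *)
Definition spokes T : nat := ed T 2 4 + ed T 2 5 + ed T 2 6.

(** With {1,6} kept, the flipped edge is either a chord of the hexagon, and the filling hides the
    flip, or it lies outside, and the flip survives the filling without removing any spoke. *)
Lemma hex_fill_step w T U : triangulation (polygon n) T -> ed T 1 6 -> ed U 1 6 ->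
  flip_step (polygon n) T U ->
  hex_fill w T = hex_fill w U /\ spokes T <= (spokes U).+1 \/
  flip_step (polygon n) (hex_fill w T) (hex_fill w U) /\ spokes T <= spokes U.
Proof.
move=> triT eT eU stepTU; have triU := flip_step_tri n1 triT stepTU.
have triT' := tri_hex_fill w triT eT; have triU' := tri_hex_fill w triU eU.
have [a [b [c [d [qT UE]]]]] := (flip_stepP n1 triT U).1 stepTU.
have [/and4P[lta ltb ltc ltd] cross _ _ eac] := qT.
have keep x y : x < n -> y < n -> ed T x y -> ~~ same x y a c -> ed U x y.
  by move=> ltx lty exy ns; rewrite UE ed_exchange // exy ns orbT.
have [inac|nin] := boolP (inhex a c).
  left; split.
    apply: tri_ext => // x y ltx lty ltxy.
    rewrite !ed_hex_fill ?neq_ltn ?ltxy //; case: ifP => // nin exy.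
    by apply: keep => //; move: nin inac; clear; rewrite /inhex /same; lia.
  rewrite /spokes.
  have drop y : 1 < y < 7 -> ed T 2 y <= ed U 2 y + same 2 y a c.
    case/andP=> _ lty; have ly : y < n := leq_trans lty n6.
    by have := keep 2 y l2 ly; case: (ed T 2 y); case: (ed U 2 y); case: (same 2 y a c) => // ->.
  (* A flip removes one edge, hence at most one spoke. *)
  have uniq_same : same 2 4 a c + same 2 5 a c + same 2 6 a c <= 1.
    by clear; rewrite /same; lia.
  rewrite /spokes; have := drop 4 isT; have := drop 5 isT; have := drop 6 isT.
  by move: uniq_same; clear; lia.
have [neac sbd] : a != c /\ ~~ same a c b d.
  by move: (cr_neq cross); clear; rewrite /same; lia.
right; split.
  apply: (flip_step_of_diff n1 triT' triU' lta ltc).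
  - by rewrite ed_hex_fill ?(negPf nin) //.
  - rewrite ed_hex_fill ?(negPf nin) //.
    by rewrite UE ed_exchange // (negPf sbd) {1}/same !eqxx.
  move=> x y ltx lty ltxy; rewrite !ed_hex_fill ?neq_ltn ?ltxy //.
  by case: ifP => // _; apply: keep.
have sm y : 1 < y < 7 -> ~~ same 2 y a c by move: nin; clear; rewrite /inhex /same; lia.
rewrite /spokes !leq_add //.
- by case: (boolP (ed T 2 4)) => // e; rewrite keep ?sm.
- by case: (boolP (ed T 2 5)) => // e; rewrite keep ?sm.
by case: (boolP (ed T 2 6)) => // e; rewrite keep ?sm.
Qed.

(* In the quadrilateral 1, 2, 3, 6 the flip replaces {2,6} by {1,3}. *)
Lemma hex_fill_last T U : triangulation (polygon n) T -> ed T 1 6 -> ed T 2 6 ->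
  ed U 1 3 -> flip_step (polygon n) T U ->
  exists2 w, hex_fill w T = U & spokes T <= 1.
Proof.
move=> triT e16 e26 e13 stepTU; have triU := flip_step_tri n1 triT stepTU.
have [a [b [c [d [qT UE]]]]] := (flip_stepP n1 triT U).1 stepTU.
have [/and4P[lta ltb ltc ltd] cross /andP[ab bc] /andP[cd da] eac] := qT.
have keep x y : x < n -> y < n -> ed T x y -> ~~ same x y a c -> ed U x y.
  by move=> ltx lty exy ns; rewrite UE ed_exchange // exy ns orbT.
have sbd : same 1 3 b d.
  move: e13; rewrite UE ed_exchange // => /orP[//|/andP[_ e13]].
  by have := tri_nc0 n1 triT n1 l3 l2 n6 e13 e26.
have sac : same 2 6 a c.
  apply/negPn/negP => ns; have := keep _ _ l2 n6 e26 ns.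
  by move=> e; have := tri_nc0 n1 triU n1 l3 l2 n6 e13 e.
(* An edge from 2 to 4 or 5 would survive the flip and cross {1,3}; so {2,6} is the last spoke. *)
have no2 y : 3 < y < 6 -> ed T 2 y = false.
  move=> lty; apply/negP=> e2y; have lyn : y < n by clear -lty l5; lia.
  have e2y' : ed U 2 y.
    by apply: keep => //; move: sac lty; clear; rewrite /same; lia.
  by have := tri_nc0 n1 triU n1 l3 l2 lyn e13 e2y'; rewrite cr_lt; clear -lty; lia.
have e36 : ed T 3 6.
  case/orP: sbd => /andP[/eqP h1 /eqP h2]; case/orP: sac => /andP[/eqP h3 /eqP h4]; subst.
  - by rewrite edC.
  - by rewrite edC edC.
  - by [].
  by rewrite edC.
have nsame x y : x != 2 -> y != 2 -> ~~ same x y a c.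
  by move: sac; clear; rewrite /same; lia.
have U36 : ed U 3 6 by apply: keep; rewrite ?nsame.
have U16 : ed U 1 6 by apply: keep; rewrite ?nsame.
(* The apex of the triangle below {3,6} is 4 or 5. This choice decides between the pairs B and C. *)
have [w Uw] : exists w : bool, if w then ed U 3 5 else ed U 4 6.
  have [k [lt3k ltk6 e3k ek6]] := @tri_split n U n1 triU 0 3 6 isT n6 U36.
  have [k4|k5] : k = 4 \/ k = 5 by clear -lt3k ltk6; lia.
    by exists false; rewrite k4 in ek6.
  by exists true; rewrite k5 in e3k.
exists w; last by rewrite /spokes (no2 4) // (no2 5) // e26.
apply: tri_ext => //; first exact: tri_hex_fill.
move=> x y ltx lty ltxy; rewrite ed_hex_fill ?neq_ltn ?ltxy //.
case: ifP => [inxy|nin exy]; last first.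
  by apply: keep => //; move: sac nin; clear; rewrite /same /inhex; lia.
have tosame i j : ed U i j -> same x y i j -> ed U x y.
  by move=> eij /orP[] /andP[/eqP-> /eqP->] //; rewrite edC.
rewrite /hexagon => /or4P[/tosame->|/tosame->|/tosame->|] //.
case/or3P=> [|/eqP yE|/eqP xE].
- by case: w Uw => e /tosame->.
- by rewrite yE (tri_side0 n1 triU) // -yE.
by rewrite xE edC (tri_side0 n1 triU) // -xE.
Qed.

End Hexagon.

(** * Links of boundary edges along a path *)

Lemma apex_unique a x y : a != x -> a.+1 != x -> a != y -> a.+1 != y ->
  ~~ cr a x a.+1 y -> ~~ cr a y a.+1 x -> x = y.
Proof. by rewrite /cr; lia. Qed.

Section Link.

Variables (n : nat) (T : {set {set 'Z_n}}).
Hypothesis n1 : 1 < n.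

Lemma link_Some a x : a < n -> link (polygon n) T a%:R%R = Some x%:R%R ->
  ed T a x && ed T a.+1 x.
Proof.
move=> lta; rewrite /link next_polygon //; case: pickP => // y + [yE].
by rewrite yE.
Qed.

(** [link] picks some apex, and [apex_unique] leaves it no choice: with two different apexes, sides
    of the two triangles would cross. *)
Lemma link_eq a x : triangulation (polygon n) T -> a.+1 < n -> x < n ->
  ed T a x -> ed T a.+1 x -> link (polygon n) T a%:R%R = Some x%:R%R.
Proof.
move=> triT lta1 ltx eax ebx; have lta := ltnW lta1.
rewrite /link next_polygon //; case: pickP => [z|].
  have [y lty ->] := natZP z n1; case/andP=> eay eby.
  congr (Some _%:R%R); apply: (@apex_unique a).
  - exact: tri_neq eay.
  - exact: tri_neq eby.
  - exact: tri_neq eax.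
  - exact: tri_neq ebx.
  - exact: (tri_nc0 n1 triT).
  exact: (tri_nc0 n1 triT).
by move/(_ x%:R%R); rewrite [_ \in T]eax [_ \in T]ebx.
Qed.

End Link.

Lemma count_incident0 (V : finType) (p : seq V) a T s :
  count id (pairmap (incident p a) T s) = 0 ->
  all (fun U => link p U a == link p T a) s.
Proof.
elim: s T => //= U s IHs T /eqP; rewrite addn_eq0 eqb0 negbK => /andP[/eqP lTU /eqP cnt].
by rewrite lTU eqxx; apply: IHs.
Qed.

Lemma last_all (V : eqType) (P : pred V) x s : P x -> all P s -> P (last x s).
Proof. by move=> Px /allP Ps; have := mem_last x s; rewrite inE => /orP[/eqP->|/Ps]. Qed.

(* Filling the hexagon in every triangulation of a path that flips on {1,2} only
   once makes each flip inside the hexagon trivial; these include the removals of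
   the spokes {2,4}, {2,5} and {2,6}. *)
Lemma hex_fill_path n (T : {set {set 'Z_n}}) s : 6 < n ->
  triangulation (polygon n) T -> path (flip_step (polygon n)) T s ->
  ed T 1 6 -> ed T 2 6 -> ed (last T s) 1 3 ->
  count id (pairmap (incident (polygon n) 1%R) T s) <= 1 ->
  exists w s', [/\ path (flip_step (polygon n)) (hex_fill w T) s',
    last (hex_fill w T) s' = last T s, all (fun U => ed U 1 3) s'
    & size s' + spokes T <= size s].
Proof.
move=> n6; have n1 : 1 < n by apply: leq_trans n6.
have l2 : 2 < n by apply: leq_trans n6. have l3 : 3 < n by apply: leq_trans n6.
elim: s T => [|U s IHs] T triT /=.
  by move=> _ e16 e26 e13; have := tri_nc0 n1 triT n1 l3 l2 n6 e13 e26.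
case/andP=> stepTU pU e16 e26 e13; have triU := flip_step_tri n1 triT stepTU.
have lkT : link (polygon n) T 1%R = Some 6%:R%R by apply: (@link_eq n T n1 1).
have [inc|ninc] := boolP (incident (polygon n) 1%R T U) => /= cnt.
  (* The only allowed incident flip is spent, so from [U] on the link keeps the value 3 that it has
     at the end. *)
  have {}cnt : count id (pairmap (incident (polygon n) 1%R) U s) = 0.
    by apply/eqP; rewrite -leqn0 -(leq_add2l 1).
  have const := count_incident0 cnt.
  have triL : triangulation (polygon n) (last U s).
    move: pU triU; elim: (s) (U) => //= W r IHr X /andP[stepXW pW] triX.
    by apply: IHr => //; apply: flip_step_tri stepXW.
  have lkL : link (polygon n) (last U s) 1%R = Some 3%:R%R.
    by apply: (@link_eq n _ n1 1) => //; apply: tri_side0.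
  have lkU : link (polygon n) U 1%R = Some 3%:R%R.
    rewrite -lkL; apply/esym/eqP.
    by apply: (last_all (P := fun W => link (polygon n) W 1%R == link (polygon n) U 1%R)).
  have allU W : link (polygon n) W 1%R = Some 3%:R%R -> ed W 1 3.
    by move/(@link_Some n W n1 1 3 n1)/andP=> [].
  have [w fillE sp] := hex_fill_last n6 triT e16 e26 (allU _ lkU) stepTU.
  exists w, s; rewrite fillE; split=> //.
    by apply/allP => W Ws; apply: allU; rewrite (eqP (allP const W Ws)).
  by clear -sp; lia.
have lkU : link (polygon n) U 1%R = Some 6%:R%R.
  by rewrite -lkT; apply/esym/eqP; rewrite -[_ == _]negbK.
have /andP[eU16 eU26] := @link_Some n U n1 1 6 n1 lkU.
have [|w [s' [ps' lasts' alls' sizes']]] := IHs U triU pU eU16 eU26 e13.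
  exact: leq_trans cnt.
exists w; have [[fillE sp]|[step sp]] := hex_fill_step n6 w triT e16 eU16 stepTU.
  exists s'; rewrite fillE; split=> //; clear -sizes' sp; lia.
exists (hex_fill w U :: s'); rewrite /= step; split=> //.
  by rewrite alls' ed_hex_fill.
by clear -sizes' sp; lia.
Qed.

(** * Removing the ear at vertex 2 *)

(* [ear_in] is the relabeling of the polygon with vertices 0, ..., m without
   vertex 2 by 0, ..., m-1, and [ear_out] is its inverse. *)
Definition ear_in m i := if i == 0 then 1 else if i == 1 then 2 else if i == m then 0 else i.
Definition ear_out m i := if i == 0 then m else if i <= 2 then i.-1 else i.

Section Ear.

Variable m : nat.
Hypothesis m6 : 6 < m.

Let m1 : 1 < m. Proof. exact: leq_trans m6. Qed.
Let n1 : 1 < m.+1. Proof. exact: leqW. Qed.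

Lemma ear_outP i : i < m -> [/\ ear_out m i < m.+1, ear_out m i != 2 & ear_in m (ear_out m i) = i].
Proof.
have m0 : (m == 0) = false by lia.
have m'1 : (m == 1) = false by lia.
case: i => [|[|[|i]]] lti; rewrite /ear_out /ear_in /= ?m0 ?m'1 ?eqxx; split=> //; try lia.
by rewrite ifF //; lia.
Qed.

Lemma ear_inP i : i < m.+1 -> i != 2 -> ear_in m i < m /\ ear_out m (ear_in m i) = i.
Proof.
rewrite /ear_in; case: i => [|[|[|i]]] //= lti _; [split=> //; lia.. |].
by case: eqP => [<-|h]; split=> //; lia.
Qed.

Lemma ear_out_inj i j : i < m -> j < m -> (ear_out m i == ear_out m j) = (i == j).
Proof.
move=> lti ltj; apply/eqP/eqP => [eq|-> //].
by have [_ _ <-] := ear_outP lti; rewrite eq; have [_ _ ->] := ear_outP ltj.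
Qed.

(** [ear_out] preserves the cyclic order of any three vertices, and crossings depend on nothing
    else. *)
Lemma cr_ear_out i j k l : i < m -> j < m -> k < m -> l < m ->
  cr (ear_out m i) (ear_out m j) (ear_out m k) (ear_out m l) = cr i j k l.
Proof.
have H a b c : a < m -> b < m -> c < m ->
    cyc3 (ear_out m a) (ear_out m b) (ear_out m c) = cyc3 a b c.
  move=> lta ltb ltc.
  have outP x : x < m -> (x == 0) && (ear_out m x == m) ||
     (0 < x) && (x < 3) && ((ear_out m x).+1 == x) || (2 < x) && (ear_out m x == x).
    by rewrite /ear_out; clear; case: x => [|[|[|x]]] //=; rewrite eqxx.
  move: (outP a lta) (outP b ltb) (outP c ltc).
  move: (ear_out m a) (ear_out m b) (ear_out m c) => a' b' c'.
  rewrite /cyc3; clear outP n1; lia.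
by move=> *; rewrite !cr_cyc3 !H.
Qed.

Lemma ear_polygon : rem 2%:R%R (polygon m.+1) =
  [seq i%:R%R : 'Z_m.+1 | i <- [:: 0; 1] ++ iota 3 (m - 2)].
Proof.
have pE : polygon m.+1 = map (fun i => i%:R%R) ([:: 0; 1] ++ 2 :: iota 3 (m - 2)).
  rewrite /polygon; congr map; have -> : m.+1 = 3 + (m - 2) by lia.
  by rewrite iotaD.
have := polygon_uniq n1; rewrite pE !map_cat [map _ (_ :: _)]/= => uq.
by rewrite rem_mid.
Qed.

Lemma relabel_ear i : i < m.+1 -> i != 2 ->
  relabel m (rem 2%:R%R (polygon m.+1)) 3%:R%R 3 (i%:R%R : 'Z_m.+1) = (ear_in m i)%:R%R.
Proof.
move=> lti ne; pose q := [seq i%:R%R : 'Z_m.+1 | i <- [:: 0; 1] ++ iota 3 (m - 2)].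
have qE : rem 2%:R%R (polygon m.+1) = rot 0 q by rewrite rot0 ear_polygon.
have uq : uniq q by rewrite -[q]rot0 -qE rem_uniq // polygon_uniq.
have sq : size q = m by rewrite size_map size_cat size_iota /=; clear -m6; lia.
pose pos j := if j < 2 then j else j.-1.
have nthq j : j < m.+1 -> j != 2 -> j%:R%R = nth 0%R q (pos j).
  move=> ltj nej; rewrite /q /pos; case: ltnP => lt2j.
    by case: j lt2j {ltj nej} => [|[|]].
  have [k jE] : exists k, j = 3 + k by exists (j - 3); clear -lt2j nej; lia.
  have ltk : k < m - 2 by clear -ltj jE; lia.
  by rewrite jE /= (nth_map 0) ?size_iota // nth_iota.
have l2 : 2 < m by apply: leq_trans m6.
have ltp : pos i < m by rewrite /pos; clear -lti ne m6; case: ifP; lia.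
rewrite [X in relabel _ _ X](nthq 3) // [X in relabel _ _ _ _ X](nthq i) //.
rewrite (relabel_nth 0%R 3 m1 qE uq sq) //.
(* Vertex 3 has position 2 once vertex 2 is removed, and it gets label 3: labels are positions plus
   one, modulo [m]. *)
have -> : pos i + (m - 2) + 3 = m + (pos i).+1 by clear -m6; lia.
rewrite natZDn // /pos /ear_in; case: i lti ne {ltp} => [|[|[|i]]] //= lti _.
by case: eqP => // ->; have := natZDn 0 m1; rewrite addn0.
Qed.

Variable T : {set {set 'Z_m.+1}}.
Hypothesis triT : triangulation (polygon m.+1) T.
Hypothesis e13 : ed T 1 3.

Let l2 : 2 < m.+1. Proof. by rewrite ltnS (leq_trans _ m6). Qed.
Let l3 : 3 < m.+1. Proof. by rewrite ltnS (leq_trans _ m6). Qed.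

Lemma ear_edge2 j : j < m.+1 -> ed T 2 j -> (j == 1) || (j == 3).
Proof.
move=> ltj e2j; have := tri_neq n1 triT l2 ltj e2j.
have := tri_nc0 n1 triT n1 l3 l2 ltj e13 e2j.
by clear; rewrite /cr; lia.
Qed.

Lemma remove_earP e : e \in remove_ear T <-> exists i j,
  [/\ i < m, j < m, i != j, ed T (ear_out m i) (ear_out m j) & e = [set i%:R; j%:R]%R].
Proof.
have img i j : i < m -> j < m -> [set relabel m (rem 2%R (polygon m.+1)) 3%R 3 x
     | x in [set (ear_out m i)%:R%R; (ear_out m j)%:R%R]] = [set i%:R; j%:R]%R.
  move=> lti ltj; have [h1 h2 h3] := ear_outP lti; have [h4 h5 h6] := ear_outP ltj.
  by rewrite imset_set2 !relabel_ear // h3 h6.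
split=> [/imsetP[e0] | [i [j [lti ltj ne eij ->]]]].
  rewrite !inE => /andP[near e0T] ->.
  have [a [b [lta ltb ltab e0E]]] := tri_edge n1 triT e0T; subst e0.
  move: near; rewrite -[1%R]/(1%:R)%R !eq_set2_natZ // => near.
  have a2 : a != 2.
    apply/eqP=> aE; rewrite aE in e0T; have := ear_edge2 ltb e0T.
    by move: near aE; clear; rewrite /same; lia.
  have b2 : b != 2.
    apply/eqP=> bE; rewrite bE setUC in e0T; have := ear_edge2 lta e0T.
    by move: near bE; clear; rewrite /same; lia.
  have [lta' aE] := ear_inP lta a2; have [ltb' bE] := ear_inP ltb b2.
  exists (ear_in m a), (ear_in m b); rewrite aE bE; split=> //.
    by rewrite -ear_out_inj // aE bE; clear -ltab; lia.
  by rewrite -(img _ _ lta' ltb') aE bE.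
apply/imsetP; exists [set (ear_out m i)%:R; (ear_out m j)%:R]%R; last by rewrite -img.
have [h1 h2 _] := ear_outP lti; have [h3 h4 _] := ear_outP ltj.
rewrite !inE [_ \in T]eij andbT.
rewrite -[1%R]/(1%:R)%R !eq_set2_natZ // /same.
by move: h2 h4; clear; lia.
Qed.

Lemma ed_remove_ear i j : i < m -> j < m ->
  ed (remove_ear T) i j = ed T (ear_out m i) (ear_out m j).
Proof.
move=> lti ltj; apply/idP/idP.
  case/remove_earP=> k [l [ltk ltl ne ekl /eqP]].
  by rewrite eq_set2_natZ // => /orP[] /andP[/eqP-> /eqP->] //; rewrite edC.
move=> eij; apply/remove_earP; exists i, j; split=> //.
have [h1 _ _] := ear_outP lti; have [h2 _ _] := ear_outP ltj.
by rewrite -ear_out_inj //; apply: tri_neq eij.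
Qed.

Lemma tri_remove_ear : triangulation (polygon m) (remove_ear T).
Proof.
apply/(triangulation_shiftP 0) => //; split.
  by move=> e /remove_earP[i [j [lti ltj ne _ ->]]]; exists i, j.
move=> i j lti ltj; rewrite !add0n ed_remove_ear //.
have [h1 ni2 _] := ear_outP lti; have [h2 nj2 _] := ear_outP ltj.
split=> [eij|[ne nc]].
  rewrite -ear_out_inj //; split=> [|k l ltk ltl]; first exact: tri_neq eij.
  rewrite !add0n ed_remove_ear // => ekl; rewrite -cr_ear_out //.
  have [h3 _ _] := ear_outP ltk; have [h4 _ _] := ear_outP ltl.
  exact: (tri_nc0 n1 triT).
apply: (tri_max0 n1 triT) => //; first by rewrite ear_out_inj.
move=> k l ltk ltl _ ekl.
have no2 y : (y == 1) || (y == 3) -> ~~ cr (ear_out m i) (ear_out m j) 2 y.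
  by move: ni2 nj2; clear; rewrite /cr => ? ? /orP[]/eqP->; lia.
have [k2|nk2] := eqVneq k 2; first by subst; apply: no2; apply: ear_edge2.
have [l2'|nl2] := eqVneq l 2.
  by subst; rewrite crCr; apply: no2; apply: ear_edge2 => //; rewrite edC.
have [ltk' kE] := ear_inP ltk nk2; have [ltl' lE] := ear_inP ltl nl2.
by rewrite -kE -lE cr_ear_out //; apply: nc => //; rewrite !add0n ed_remove_ear // kE lE.
Qed.

End Ear.

Section AddEar.

Variable m : nat.
Hypothesis m6 : 6 < m.

Let m1 : 1 < m. Proof. exact: leq_trans m6. Qed.
Let n1 : 1 < m.+1. Proof. exact: leqW. Qed.
Let l2 : 2 < m.+1. Proof. by rewrite ltnS (leq_trans _ m6). Qed.
Let l3 : 3 < m.+1. Proof. by rewrite ltnS (leq_trans _ m6). Qed.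

Implicit Types (T : {set {set 'Z_m.+1}}) (U : {set {set 'Z_m}}).

Definition add_ear_rel U : rel nat := fun i j =>
  (i != j) && (if i == 2 then (j == 1) || (j == 3)
               else if j == 2 then (i == 1) || (i == 3)
               else ed U (ear_in m i) (ear_in m j)).

Definition add_ear U := edge_set m.+1 (add_ear_rel U).

Lemma add_ear_relC U i j : add_ear_rel U i j = add_ear_rel U j i.
Proof.
rewrite /add_ear_rel eq_sym edC; have [->|ni] := eqVneq i 2.
  by case: (j =P 2) => [->|].
by case: (j =P 2).
Qed.

Lemma ed_add_ear U i j : i < m.+1 -> j < m.+1 -> ed (add_ear U) i j = add_ear_rel U i j.
Proof.
move=> lti ltj; rewrite ed_edge_set // => [x|x y]; first by rewrite /add_ear_rel eqxx.
exact: add_ear_relC.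
Qed.

Lemma ed_add_ear_out U i j : triangulation (polygon m) U -> i < m -> j < m ->
  ed (add_ear U) (ear_out m i) (ear_out m j) = ed U i j.
Proof.
move=> triU lti ltj; have [h1 h2 h3] := ear_outP m6 lti; have [h4 h5 h6] := ear_outP m6 ltj.
rewrite ed_add_ear // /add_ear_rel (negPf h2) (negPf h5) h3 h6 ear_out_inj //.
by apply/andb_idl; apply: tri_neq.
Qed.

Lemma add_ear13 U : triangulation (polygon m) U -> ed (add_ear U) 1 3.
Proof.
move=> triU; rewrite ed_add_ear // /add_ear_rel /= /ear_in.
have -> : (1 == m) = false by clear -m6; lia.
have -> : (3 == m) = false by clear -m6; lia.
by apply: tri_side0 => //; apply: leq_trans m6.
Qed.

Lemma tri_add_ear U : triangulation (polygon m) U -> triangulation (polygon m.+1) (add_ear U).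
Proof.
move=> triU; apply: tri_edge_set => //.
- by move=> x; rewrite /add_ear_rel eqxx.
- exact: add_ear_relC.
- move=> i j k l ltij ltj ltkl ltl; have lti := ltn_trans ltij ltj.
  have ltk := ltn_trans ltkl ltl.
  rewrite /add_ear_rel !neq_ltn ltij ltkl /= !cr_lt //.
  case: (i =P 2) => [->|ni2].
    by move=> h _; move: h ltij ltkl; clear; lia.
  case: (j =P 2) => [->|nj2].
    by move=> h _; move: h ltij ltkl; clear; lia.
  case: (k =P 2) => [->|nk2].
    by move=> _ h; move: h ltij ltkl; clear -ni2 nj2; lia.
  case: (l =P 2) => [->|nl2].
    by move=> _ h; move: h ltij ltkl; clear -ni2 nj2; lia.
  rewrite -cr_lt //.
  move/eqP: ni2 => ni2; move/eqP: nj2 => nj2; move/eqP: nk2 => nk2; move/eqP: nl2 => nl2.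
  have [h1 iE] := ear_inP m6 lti ni2; have [h2 jE] := ear_inP m6 ltj nj2.
  have [h3 kE] := ear_inP m6 ltk nk2; have [h4 lE] := ear_inP m6 ltl nl2.
  move=> eij ekl; rewrite -iE -jE -kE -lE cr_ear_out //.
  exact: (tri_nc0 m1 triU).
move=> i j ltij ltj nc; have lti := ltn_trans ltij ltj.
(* The edge {1,3} cuts vertex 2 off, which settles every chord at 2. *)
have R13 : add_ear_rel U 1 3 by rewrite -ed_add_ear // add_ear13.
have nc13 := nc 1 3 isT l3 R13.
rewrite /add_ear_rel neq_ltn ltij /=.
case: (i =P 2) => [iE|/eqP ni2].
  by move: nc13 ltij; rewrite iE /cr; clear; lia.
case: (j =P 2) => [jE|/eqP nj2].
  by move: nc13 ltij; rewrite jE /cr; clear; lia.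
have [h1 iE] := ear_inP m6 lti ni2; have [h2 jE] := ear_inP m6 ltj nj2.
apply: (tri_max0 m1 triU) => //.
  by rewrite -(ear_out_inj m6) // iE jE neq_ltn ltij.
move=> k l ltk ltl ltkl ekl; rewrite -(cr_ear_out m6) // iE jE.
have [h3 nk2 kE] := ear_outP m6 ltk; have [h4 nl2 lE] := ear_outP m6 ltl.
have Rkl : add_ear_rel U (ear_out m k) (ear_out m l) by rewrite -ed_add_ear // ed_add_ear_out.
case: (ltngtP (ear_out m k) (ear_out m l)) => h.
- exact: nc.
- by rewrite crCr; apply: nc; rewrite // add_ear_relC.
by rewrite h /cr; clear; lia.
Qed.

Lemma remove_earK T : triangulation (polygon m.+1) T -> ed T 1 3 ->
  add_ear (remove_ear T) = T.
Proof.
move=> triT e13; have triR := tri_remove_ear m6 triT e13.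
apply/esym/tri_ext => //; first exact: tri_add_ear.
move=> i j lti ltj ltij eij; rewrite ed_add_ear // /add_ear_rel neq_ltn ltij /=.
case: (i =P 2) => [iE|/eqP ni2]; first by subst; apply: (ear_edge2 m6 triT e13).
case: (j =P 2) => [jE|/eqP nj2].
  by subst; apply: (ear_edge2 m6 triT e13); rewrite // edC.
have [h1 iE] := ear_inP m6 lti ni2; have [h2 jE] := ear_inP m6 ltj nj2.
by rewrite ed_remove_ear // iE jE.
Qed.

Lemma add_ear_step U W : flip_step (polygon m) U W ->
  flip_step (polygon m.+1) (add_ear U) (add_ear W).
Proof.
move=> stepUW; have triU : triangulation (polygon m) U by case/andP: stepUW.
have triW := flip_step_tri m1 triU stepUW.
have [a [b [c [d [qU WE]]]]] := (flip_stepP m1 triU W).1 stepUW.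
have [/and4P[lta ltb ltc ltd] cross _ _ eac] := qU.
have [h1 na2 aE] := ear_outP m6 lta; have [h2 nc2 cE] := ear_outP m6 ltc.
apply: (flip_step_of_diff n1 (tri_add_ear triU) (tri_add_ear triW) h1 h2).
- by rewrite ed_add_ear_out.
- rewrite ed_add_ear_out // WE ed_exchange //.
  by move: (cr_neq cross); clear; rewrite /same; lia.
move=> x y ltx lty ltxy; rewrite !ed_add_ear // /add_ear_rel neq_ltn ltxy /=.
case: (x =P 2) => // /eqP nx2; case: (y =P 2) => // /eqP ny2 exy ns.
have [h3 xE] := ear_inP m6 ltx nx2; have [h4 yE] := ear_inP m6 lty ny2.
rewrite WE ed_exchange // exy andbT orbC.
have -> // : ~~ same (ear_in m x) (ear_in m y) a c.
apply: contra ns => /orP[] /andP[/eqP <- /eqP <-].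
  by rewrite xE yE /same !eqxx.
by rewrite xE yE /same !eqxx orbT.
Qed.

(** The flipped edge avoids vertex 2: the only edges there are {1,2} and {2,3}, which are sides of
    the polygon and are never lost. *)
Lemma remove_ear_step T T' : flip_step (polygon m.+1) T T' -> ed T 1 3 -> ed T' 1 3 ->
  flip_step (polygon m) (remove_ear T) (remove_ear T').
Proof.
move=> stepTT e13 e13'; have triT : triangulation (polygon m.+1) T by case/andP: stepTT.
have triT' := flip_step_tri n1 triT stepTT.
have [a [b [c [d [qT TE]]]]] := (flip_stepP n1 triT T').1 stepTT.
have [/and4P[lta ltb ltc ltd] cross _ _ eac] := qT.
have neac' : ed T' a c = false.
  by rewrite TE ed_exchange //; move: (cr_neq cross); clear; rewrite /same; lia.
have side y : (y == 1) || (y == 3) -> ed T' 2 y.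
  by case/orP=> /eqP->; [rewrite edC |]; apply: (tri_side0 n1 triT').
have na2 : a != 2.
  apply/eqP=> aE; subst; have := side c (ear_edge2 m6 triT e13 ltc eac).
  by rewrite neac'.
have nc2 : c != 2.
  apply/eqP=> cE; subst; rewrite edC in eac.
  by have := side a (ear_edge2 m6 triT e13 lta eac); rewrite edC neac'.
have [h1 aE] := ear_inP m6 lta na2; have [h2 cE] := ear_inP m6 ltc nc2.
apply: (flip_step_of_diff m1 (tri_remove_ear m6 triT e13) (tri_remove_ear m6 triT' e13') h1 h2).
- by rewrite ed_remove_ear // aE cE.
- by rewrite ed_remove_ear // aE cE neac'.
move=> x y ltx lty _; rewrite !ed_remove_ear // => exy ns.
have [h3 _ _] := ear_outP m6 ltx; have [h4 _ _] := ear_outP m6 lty.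
rewrite TE ed_exchange // exy andbT orbC.
have -> // : ~~ same (ear_out m x) (ear_out m y) a c.
by rewrite -aE -cE /same !ear_out_inj.
Qed.

End AddEar.

(** Counted from a+1, the boundary edge {a, a+1} is the base {0, n-1}, and the vertex sought is the
    apex below it. *)
Lemma link_exists n (T : {set {set 'Z_n}}) a : triangulation (polygon n) T ->
  2 < n -> a.+1 < n -> exists2 x, x < n & ed T a x && ed T a.+1 x.
Proof.
move=> triT n2 lta; have n1 := ltnW n2.
have n0 : 1 < n.-1 by lia.
have ltn : n.-1 < n by lia.
have [k [k0 ltk ebk eak]] := tri_split n1 triT n0 ltn (tri_base n1 triT a.+1).
have [x ltx [xE _]] := natZ_shift a.+1 n1 (ltn_trans ltk ltn).
exists x => //; move: ebk eak; rewrite /ed xE addn0 => ->.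
have -> : a.+1 + n.-1 = n + a by lia.
by rewrite natZDn // setUC => ->.
Qed.

(** * Three flips that fill the hexagon of the first triangulation *)

Section Start.

Variables (n : nat) (T : {set {set 'Z_n}}).
Hypothesis n6 : 6 < n.
Hypothesis triT : triangulation (polygon n) T.
Hypotheses (e16 : ed T 1 6) (e24 : ed T 2 4) (e25 : ed T 2 5) (e26 : ed T 2 6).

Let n1 : 1 < n. Proof. exact: leq_trans n6. Qed.
Let l2 : 2 < n. Proof. exact: leq_trans n6. Qed.
Let l3 : 3 < n. Proof. exact: leq_trans n6. Qed.
Let l4 : 4 < n. Proof. exact: leq_trans n6. Qed.
Let l5 : 5 < n. Proof. exact: leq_trans n6. Qed.

(** For [false] the edges {2,5}, {2,4}, {2,6} are flipped in the order of the definition of B.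
    Flipping {2,4} before {2,5} instead creates {3,5} in place of {4,6}, which is the case
    [true]. *)
Let T1 w := if w then exchange T 2 3 4 5 else exchange T 2 4 5 6.
Let T2 w := if w then exchange (T1 w) 2 3 5 6 else exchange (T1 w) 2 3 4 6.
Let T3 w := exchange (T2 w) 2 3 6 1.

Let quad1 w : if w then quad T 2 3 4 5 else quad T 2 4 5 6.
Proof.
have [e23 e34] := (tri_side0 n1 triT l3, tri_side0 n1 triT l4).
have [e45 e56] := (tri_side0 n1 triT l5, tri_side0 n1 triT n6).
by case: w; split; rewrite ?n1 ?l2 ?l3 ?l4 ?l5 ?n6 ?e23 ?e34 ?e45 ?e56 ?e24 //= edC.
Qed.

Let tri1 w : triangulation (polygon n) (T1 w).
Proof. by case: w (quad1 w) => q; apply: tri_exchange. Qed.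

Let quad2 w : if w then quad (T1 w) 2 3 5 6 else quad (T1 w) 2 3 4 6.
Proof.
have [e23 e34] := (tri_side0 n1 (tri1 w) l3, tri_side0 n1 (tri1 w) l4).
have e56 := tri_side0 n1 (tri1 w) n6.
case: w e23 e34 e56 => e23 e34 e56; split; rewrite ?n1 ?l2 ?l3 ?l4 ?l5 ?n6 //= ?e23 ?e34 ?e56 //=.
all: rewrite ?(edC _ 6) !ed_exchange //= ?e24 ?e25 ?e26 //.
Qed.

Let tri2 w : triangulation (polygon n) (T2 w).
Proof. by case: w (quad2 w) (tri1 w) => q t; apply: tri_exchange. Qed.

Let quad3 w : quad (T2 w) 2 3 6 1.
Proof.
have [e12 e23] := (tri_side0 n1 (tri2 w) l2, tri_side0 n1 (tri2 w) l3).
split; rewrite ?n1 ?l2 ?l3 ?l4 ?l5 ?n6 //= ?e12 ?e23 //=; rewrite ?(edC _ 6) ?e12 ?andbT.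
all: by case: w {e12 e23}; rewrite !ed_exchange //= ?e16 ?e26.
Qed.

Let ed3 w x y : x < n -> y < n -> ed (T3 w) x y =
  same x y 3 1 || ~~ same x y 2 6 && (same x y 3 6 ||
  (if w then ~~ same x y 2 5 && (same x y 3 5 || ~~ same x y 2 4 && ed T x y)
   else ~~ same x y 2 4 && (same x y 4 6 || ~~ same x y 2 5 && ed T x y))).
Proof. by move=> ltx lty; case: w; rewrite !ed_exchange. Qed.

Let T3E w : T3 w = hex_fill w T.
Proof.
have tri3 : triangulation (polygon n) (T3 w) by apply: tri_exchange.
apply/esym/tri_ext => //; first exact: tri_hex_fill.
move=> x y ltx lty ltxy; rewrite ed_hex_fill ?neq_ltn ?ltxy //.
case: ifP => [inxy|nin exy]; last first.
  have ns z : 1 < z < 7 -> same x y 2 z = false.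
    by move: nin; clear; rewrite /same /inhex; lia.
  by rewrite ed3 // !ns // exy; case: (w); rewrite /= !orbT.
have tosame i j : ed (T3 w) i j -> same x y i j -> ed (T3 w) x y.
  by move=> eij /orP[] /andP[/eqP-> /eqP->] //; rewrite edC.
rewrite /hexagon => /or4P[/tosame->|/tosame->|/tosame->|] //.
- by rewrite ed3 //= e16; case: (w).
- by rewrite ed3.
- by rewrite ed3.
case/or3P=> [|/eqP yE|/eqP xE].
- by case: w tosame {tri3} => tosame /tosame-> //; rewrite ed3.
- by rewrite yE (tri_side0 n1 tri3) // -yE.
by rewrite xE edC (tri_side0 n1 tri3) // -xE.
Qed.

Lemma hex_start w : exists s, [/\ size s = 3, path (flip_step (polygon n)) T s
  & last T s = hex_fill w T].
Proof.
exists [:: T1 w; T2 w; T3 w]; split; [by []| | by rewrite -T3E].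
rewrite /=; apply/and4P; split=> //.
- apply/flip_stepP => //; case: w (quad1 w) => q.
    by exists 2, 3, 4, 5.
  by exists 2, 4, 5, 6.
- apply/flip_stepP => //; case: w (quad2 w) => q.
    by exists 2, 3, 5, 6.
  by exists 2, 3, 4, 6.
by apply/flip_stepP => //; exists 2, 3, 6, 1.
Qed.

Lemma flips_hex_fill : let flip := flip (polygon n) in
  (flip (flip (flip T [set 2; 5]) [set 2; 4]) [set 2; 6] = hex_fill false T)%R.
Proof.
rewrite /= (flip_quad n1 triT (quad1 false)).
rewrite (flip_quad n1 (tri1 false) (quad2 false)).
by rewrite (flip_quad n1 (tri2 false) (quad3 false)) -T3E.
Qed.

End Start.

(** * The first triangulations of B and C as filled hexagons without the ear *)

Section Pairs.

Variable m : nat.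
Hypothesis m6 : 6 < m.

Let m1 : 1 < m. Proof. exact: leq_trans m6. Qed.
Let n6 : 6 < m.+1. Proof. exact: leqW. Qed.
Let n7 : 7 < m.+1. Proof. by []. Qed.
Let n1 : 1 < m.+1. Proof. exact: leqW. Qed.
Let T := A_minus m.+1.
Let triT : triangulation (polygon m.+1) T. Proof. exact: tri_A_minus. Qed.

Lemma B_minus_hex : B_minus m = remove_ear (hex_fill false T).
Proof.
by have [e24 e25 e26 e16] := A_minus_edges n7; rewrite /B_minus flips_hex_fill.
Qed.

Lemma tri_hex_A w : triangulation (polygon m.+1) (hex_fill w T).
Proof. by have [_ _ _ e16] := A_minus_edges n7; apply: tri_hex_fill. Qed.

Lemma hex_A13 w : ed (hex_fill w T) 1 3.
Proof. by rewrite ed_hex_fill // (leq_trans _ n6). Qed.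

Lemma ed_remove_hex w i j : i < m -> j < m -> ed (remove_ear (hex_fill w T)) i j =
  ed (hex_fill w T) (ear_out m i) (ear_out m j).
Proof. by move=> lti ltj; rewrite ed_remove_ear ?tri_hex_A ?hex_A13. Qed.

Lemma C_minus_hex : C_minus m = remove_ear (hex_fill true T).
Proof.
have l3 : 3 < m by apply: leq_trans m6. have l4 : 4 < m by apply: leq_trans m6.
have l5 : 5 < m by apply: leq_trans m6.
have triR w := tri_remove_ear m6 (tri_hex_A w) (hex_A13 w).
have l3' := leqW l3. have l4' := leqW l4. have l5' := leqW l5.
(* The relabeling fixes 3, 4, 5 and 6, so the flip of {4,6} takes place in the quadrilateral 3, 4,
   5, 6 and creates {3,5}. *)
have q : quad (remove_ear (hex_fill false T)) 4 5 6 3.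
  by split; rewrite ?l3 ?l4 ?l5 ?m6 // !ed_remove_hex // !ed_hex_fill.
rewrite /C_minus B_minus_hex (flip_quad m1 (triR false) q).
apply: tri_ext => //; first exact: tri_exchange.
move=> x y ltx lty ltxy; rewrite ed_exchange // !ed_remove_hex //.
have [h1 _ _] := ear_outP m6 ltx; have [h2 _ _] := ear_outP m6 lty.
have ne : ear_out m x != ear_out m y by rewrite ear_out_inj // neq_ltn ltxy.
have sE i j : i < m -> j < m ->
    same x y i j = same (ear_out m x) (ear_out m y) (ear_out m i) (ear_out m j).
  by move=> lti ltj; rewrite /same !ear_out_inj.
rewrite !sE // !ed_hex_fill //; case/orP.
  by case/orP=> /andP[/eqP-> /eqP->].
case/andP=> /negPf; rewrite /= => ns; case: ifP => // _.
by rewrite /hexagon ns => /or4P[->|->|->|]; rewrite ?orbT // => /orP[//|->]; rewrite !orbT.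
Qed.

End Pairs.

(** * Paths with the ear removed or glued back *)

Section EarPaths.

Variable m : nat.
Hypothesis m6 : 6 < m.

Let m1 : 1 < m. Proof. exact: leq_trans m6. Qed.
Let n1 : 1 < m.+1. Proof. exact: leqW. Qed.

Lemma remove_ear_path (T : {set {set 'Z_m.+1}}) s : ed T 1 3 -> all (fun U => ed U 1 3) s ->
  path (flip_step (polygon m.+1)) T s ->
  path (flip_step (polygon m)) (remove_ear T) (map (@remove_ear m) s).
Proof.
elim: s T => //= U s IHs T e13 /andP[eU alls] /andP[stepTU pU].
by rewrite remove_ear_step //= IHs.
Qed.

Lemma add_ear_path (U : {set {set 'Z_m}}) s :
  path (flip_step (polygon m)) U s ->
  path (flip_step (polygon m.+1)) (add_ear U) (map (@add_ear m) s).
Proof.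
elim: s U => //= W s IHs U /andP[stepUW pW].
by rewrite add_ear_step //= IHs.
Qed.

(** The edge {3,4} keeps its labels when the ear is glued on, and its link is carried along by the
    injective map [ear_out]. *)
Lemma incident_add_ear (U W : {set {set 'Z_m}}) : triangulation (polygon m) U ->
  triangulation (polygon m) W -> incident (polygon m) 3%R U W ->
  incident (polygon m.+1) 3%R (add_ear U) (add_ear W).
Proof.
move=> triU triW; apply: contra => /eqP eq_link; apply/eqP.
have l2 : 2 < m by apply: leq_trans m6. have l4 : 4 < m by apply: leq_trans m6.
have l3 := ltnW l4.
have lk (X : {set {set 'Z_m}}) : triangulation (polygon m) X -> exists2 x, x < m &
    link (polygon m) X 3%R = Some x%:R%R /\
    link (polygon m.+1) (add_ear X) 3%R = Some (ear_out m x)%:R%R.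
  move=> triX; have [x ltx /andP[e3x e4x]] := link_exists triX l2 l4.
  exists x => //; split; first exact: (link_eq m1 triX l4 ltx e3x e4x).
  have [ltx' _ _] := ear_outP m6 ltx.
  apply: (link_eq n1 (tri_add_ear m6 triX) (leqW l4) ltx').
    by rewrite -[3]/(ear_out m 3) ed_add_ear_out.
  by rewrite -[4]/(ear_out m 4) ed_add_ear_out.
have [x ltx [lkx lkx']] := lk U triU; have [y lty [lky lky']] := lk W triW.
move: eq_link; rewrite lkx lky lkx' lky' => -[/eqP].
have [ltx' _ _] := ear_outP m6 ltx; have [lty' _ _] := ear_outP m6 lty.
by rewrite natZ_eq // ear_out_inj // => /eqP->.
Qed.

Lemma count_incident_add_ear (U : {set {set 'Z_m}}) s : triangulation (polygon m) U ->
  path (flip_step (polygon m)) U s ->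
  count id (pairmap (incident (polygon m) 3%R) U s) <=
  count id (pairmap (incident (polygon m.+1) 3%R) (add_ear U) (map (@add_ear m) s)).
Proof.
elim: s U => //= W s IHs U triU /andP[stepUW pW].
have triW := flip_step_tri m1 triU stepUW.
apply: leq_add; last exact: IHs.
case: (boolP (incident (polygon m) 3%R U W)) => // inc.
by rewrite (incident_add_ear triU triW inc).
Qed.

End EarPaths.

Theorem theorem8 (n : nat) (hn : 7 < n)
    (h1 : theta (polygon n) (A n) 1%R <= 1)
    (h3 : theta (polygon n) (A n) 3%R <= 2) :
  exists P : {set {set 'Z_n.-1}} * {set {set 'Z_n.-1}},
    [/\ P = B n.-1 \/ P = C n.-1,
        delta (polygon n.-1) P + 3 = delta (polygon n) (A n)
      & theta (polygon n.-1) P 3%R <= 1].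
Proof.
case: n hn h1 h3 => // m m6 h1 h3; rewrite [m.+1.-1]/=.
have n6 : 6 < m.+1 := ltnW m6.
have m1 : 1 < m by apply: (@leq_trans 7).
have n1 : 1 < m.+1 := leqW m1.
have l4 : 4 < m.+1 by apply: leq_trans n6.
have l5 : 5 < m.+1 by apply: leq_trans n6.
have [e24 e25 e26 e16] := A_minus_edges m6; have e13 := A_plus_edge m6.
have triT := tri_A_minus m6; have triU := tri_A_plus m6.
set T := A_minus m.+1 in e24 e25 e26 e16 triT *; set U := A_plus m.+1 in e13 triU *.
have geodesic_theta (a : 'Z_m.+1) (s : seq {set {set 'Z_m.+1}}) :
    size s = delta (polygon m.+1) (A m.+1) -> flip_path (polygon m.+1) T U s ->
    count id (pairmap (incident (polygon m.+1) a) T s) <= theta (polygon m.+1) (A m.+1) a.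
  move=> /eqP size_s path_s.
  exact: (leq_bigmax_cond
    (P := fun s : (delta (polygon m.+1) (A m.+1)).-tuple _ =>
            flip_path (polygon m.+1) T U s)
    (F := fun s => count id (pairmap (incident (polygon m.+1) a) T s))
    (Tuple size_s)).
have [s0 path_s0] := flip_connected n1 triT triU.
have [t path_t] := delta_path path_s0.
have [pt /eqP last_t] := andP path_t.
have [||w [s [ps last_s all_s size_s]]] := hex_fill_path n6 triT pt e16 e26.
- by rewrite last_t.
- by apply: leq_trans h1; apply: geodesic_theta path_t; rewrite size_tuple.
(* All three spokes are present in the first triangulation of A. *)
have {}size_s : size s + 3 <= delta (polygon m.+1) (A m.+1).
  by move: size_s; rewrite size_tuple /spokes e24 e25 e26.
have fill13 := hex_A13 m6 w; have tri_fill := tri_hex_A m6 w.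
set H := hex_fill w T in ps last_s fill13 tri_fill.
have triP := tri_remove_ear m6 tri_fill fill13.
have addP : add_ear (remove_ear H) = H by apply: remove_earK.
have addB : add_ear (B_plus m) = U by apply: remove_earK.
set P := (remove_ear H, B_plus m).
have [r [size_r path_r last_r]] := hex_start n6 triT e16 e24 e25 e26 w.
have path_P : flip_path (polygon m) P.1 P.2 (map (@remove_ear m) s).
  by rewrite /flip_path remove_ear_path //= last_map last_s last_t eqxx.
have lift v : flip_path (polygon m) P.1 P.2 v ->
    flip_path (polygon m.+1) T U (r ++ map (@add_ear m) v).
  case/andP=> path_v /eqP last_v; rewrite /flip_path cat_path path_r last_cat last_r.
  by rewrite -/H -addP add_ear_path //= last_map last_v addB eqxx.
(* The filled path without the ear bounds the left side from above; a geodesic for [P], lifted and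
   preceded by the three flips of [r], bounds it from below. By this equality such lifts are
   geodesics for A. *)
have deltaP : delta (polygon m) P + 3 = delta (polygon m.+1) (A m.+1).
  apply/eqP; rewrite eqn_leq; apply/andP; split.
    apply: leq_trans size_s; rewrite leq_add2r -(size_map (@remove_ear m)).
    exact: delta_min.
  have [v path_v] := delta_path path_P.
  by have := delta_min (lift v path_v); rewrite size_cat size_map size_tuple size_r addnC.
exists P; split=> //.
  rewrite /P /H; case: (w); [right | left].
    by rewrite /C C_minus_hex.
  by rewrite /B B_minus_hex.
apply/bigmax_leqP => v path_v.
have := geodesic_theta 3%R (r ++ map (@add_ear m) v) _ (lift v path_v).
rewrite size_cat size_map size_tuple size_r addnC deltaP => /(_ erefl).
rewrite pairmap_cat count_cat last_r -/H => /leq_trans/(_ h3).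
(* The link of {3,4} is 2 before the three flips and 5 or 6 after them, so one of the at most two
   incident flips is used up in [r]. *)
have r_inc : 0 < count id (pairmap (incident (polygon m.+1) 3%R) T r).
  rewrite lt0n; apply/eqP => /count_incident0 const.
  have := last_all
    (P := fun X => link (polygon m.+1) X 3%R == link (polygon m.+1) T 3%R)
    (eqxx _) const.
  rewrite last_r -/H.
  have l2 : 2 < m.+1 by apply: leq_trans n6. have l3 : 3 < m.+1 by apply: leq_trans n6.
  have -> : link (polygon m.+1) T 3%R = Some 2%:R%R.
    apply: (link_eq n1 triT l4 l2); last by rewrite edC.
    by rewrite edC; apply: tri_side0.
  have lkH x : x < m.+1 -> ed H 3 x -> ed H 4 x -> link (polygon m.+1) H 3%R = Some x%:R%R.
    exact: (link_eq n1 tri_fill l4).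
  rewrite (lkH (if w then 5 else 6)).
  - by move=> /eqP[/eqP]; rewrite natZ_eq //; case: (w).
  - by case: (w).
  - by rewrite ed_hex_fill //; case: (w).
  by rewrite ed_hex_fill //; case: (w).
have [path_v' _] := andP path_v.
have := count_incident_add_ear m6 triP path_v'; rewrite addP => h.
by move=> /(leq_trans (leq_add r_inc h)).
Qed.
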